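(* Let $H$ be a hypergraph and let $v$ be a vertex of $H$ such that $v$ is not isolated in $H$ and $v$ is not contained in any induced Berge cycle of length $3$ in $H$. Then: (1) there is a hypergraph $H'$ with $V(H') \subseteq V(H) \setminus \{v\}$ such that $I(H) \simeq \Sigma I(H')$; (2) $I(H)$ has the homotopy type of a suspension; (3) the reduced homology group $\tilde{H}_1(I(H);\mathbb{Z})$ is a free abelian group.
   Context: A hypergraph $H$ on a finite set $V=V(H)$ is a collection of nonempty subsets of $V$, called edges. Standing convention: every edge of $H$ is inclusion-minimal (no edge properly contains another edge) and has size at least $2$. An independent set of $H$ is a subset of $V(H)$ containing no edge of $H$; the independence complex $I(H)$ is the simplicial complex of all independent sets of $H$. A vertex is isolated if it lies in no edge. A Berge cycle of length $k$ in $H$ is an alternating sequence $v_1 e_1 v_2 e_2 \cdots v_k e_k$ of $k$ distinct vertices and $k$ distinct edges of $H$ with $v_i, v_{i+1} \in e_i$ for all $i$ (indices modulo $k$); it is induced if $e_i \cap \{v_1,\ldots,v_k\} = \{v_i, v_{i+1}\}$ for all $i$ and no edge of $H$ contains two non-consecutive vertices of the cycle. $\Sigma X$ denotes the suspension of $X$ and $\simeq$ homotopy equivalence. *)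

(* Defs.v *)
From HB Require Import structures.
From mathcomp Require Import all_boot all_order all_algebra finmap.
From mathcomp Require Import generic_quotient ring_quotient.
From mathcomp Require Import all_classical all_reals all_analysis.

Set Implicit Arguments.
Unset Strict Implicit.
Unset Printing Implicit Defensive.

Import Order.TTheory GRing.Theory Num.Theory.
Import numFieldNormedType.Exports.

Local Open Scope ring_scope.
Local Open Scope quotient_scope.

(** * Hypergraphs *)

Record hypergraph (T : finType) := Hypergraph {
  vertices : {set T};
  edges : {set {set T}};
  edges_sub : forall e : {set T}, e \in edges -> e \subset vertices;
  edges_minimal : forall e f : {set T}, e \in edges -> f \in edges ->
    e \subset f -> e = f;
  edges_size : forall e : {set T}, e \in edges -> (2 <= #|e|)%N }.

Definition isolated_vertex (T : finType) (H : hypergraph T) (v : T) : Prop :=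
  forall e, e \in edges H -> v \notin e.

(* Indices are taken modulo [k]: [ordS i] is the cyclic successor of [i]. *)
Definition berge_cycle (T : finType) (H : hypergraph T) (k : nat)
    (v : 'I_k -> T) (e : 'I_k -> {set T}) : Prop :=
  [/\ injective v, injective e, forall i, e i \in edges H
    & forall i, (v i \in e i) /\ (v (ordS i) \in e i)].

Definition induced_berge_cycle (T : finType) (H : hypergraph T) (k : nat)
    (v : 'I_k -> T) (e : 'I_k -> {set T}) : Prop :=
  [/\ berge_cycle H v e,
      forall i, e i :&: [set v j | j : 'I_k]%SET = [set v i; v (ordS i)]%SET
    & forall i j, j != i -> j != ordS i -> i != ordS j ->
        forall f, f \in edges H -> ~ (v i \in f /\ v j \in f)].

Definition on_induced_berge_cycle (T : finType) (H : hypergraph T) (k : nat)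
    (x : T) : Prop :=
  exists (v : 'I_k -> T) (e : 'I_k -> {set T}),
    induced_berge_cycle H v e /\ exists i, v i = x.

(** * Simplicial complexes and independence complexes *)

(* The vertices of the complex are the [x] with [[set x]] a face; not every
   element of [T] has to be one. *)
Record scomplex (T : finType) := SComplex {
  faces : {set {set T}};
  faces_closed : forall s t : {set T}, s \in faces -> t \subset s -> t \in faces }.

Definition independent_sets (T : finType) (H : hypergraph T) : {set {set T}} :=
  [set s : {set T} | (s \subset vertices H) &&
     [forall (e : {set T} | e \in edges H), ~~ (e \subset s)]]%SET.

Lemma independent_sets_closed (T : finType) (H : hypergraph T)
    (s t : {set T}) :
  s \in independent_sets H -> t \subset s -> t \in independent_sets H.
Proof.
rewrite !inE => /andP[sH /forall_inP sI] ts.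
rewrite (fintype.subset_trans ts sH); apply/forall_inP => e /sI.
by apply: contra => es; exact: fintype.subset_trans es ts.
Qed.

Definition independence_complex (T : finType) (H : hypergraph T) : scomplex T :=
  SComplex (@independent_sets_closed T H).

(** * Topology *)

(* Points are given by their barycentric coordinates. *)
Definition realization_set (R : realType) (T : finType) (K : scomplex T) :
    set {ptws T -> R} :=
  [set x : {ptws T -> R} | [/\ forall i : T, 0 <= x i, \sum_(i : T) x i = 1
     & [set i : T | x i != 0]%SET \in faces K]]%classic.

Definition realization (R : realType) (T : finType) (K : scomplex T) :
    topologicalType :=
  set_type (@realization_set R T K).

Definition unit_interval (R : realType) : topologicalType :=
  set_type (`[0, 1]%classic : set R).

Definition homotopic (R : realType) (X Y : topologicalType) (f g : X -> Y) :
    Prop :=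
  exists F : X * unit_interval R -> Y, continuous F /\
    (forall x t, (val t = 0 -> F (x, t) = f x) /\
                 (val t = 1 -> F (x, t) = g x)).

Definition homotopy_equivalent (R : realType) (X Y : topologicalType) : Prop :=
  exists (f : X -> Y) (g : Y -> X), [/\ continuous f, continuous g,
    homotopic R (g \o f) idfun & homotopic R (f \o g) idfun].

Section Suspension.
Variables (R : realType) (X : topologicalType).

(* The suspension is [X * [0, 1]] plus two poles, with [X * {0}] glued to the
   pole [false] and [X * {1}] to the pole [true]. Having the poles as separate
   points makes the suspension of the empty space a two-point space. *)
Definition susp_part (b : bool) : topologicalType :=
  if b then bool : topologicalType else (X * unit_interval R)%type.

Definition susp_sum : topologicalType := {b : bool & susp_part b}.

Definition susp_pole (p : susp_sum) : option bool :=
  match p with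
  | existT true b => Some b
  | existT false xt =>
      if val xt.2 == 0 then Some false
      else if val xt.2 == 1 then Some true else None
  end.

Definition susp_glue (p q : susp_sum) : bool :=
  (p == q) || ((susp_pole p != None) && (susp_pole p == susp_pole q)).

Lemma susp_glue_refl : reflexive susp_glue.
Proof. by move=> p; rewrite /susp_glue eqxx. Qed.

Lemma susp_glue_sym : symmetric susp_glue.
Proof.
move=> p q; rewrite /susp_glue (eq_sym p) (eq_sym (susp_pole p) (susp_pole q)).
by case: (susp_pole q =P susp_pole p) => [->|_]; rewrite ?andbF.
Qed.

Lemma susp_glue_trans : transitive susp_glue.
Proof.
move=> q p r; rewrite /susp_glue => /predU1P[->//|/andP[p0 /eqP pq]].
by move=> /predU1P[<-|/andP[_ /eqP <-]]; rewrite p0 pq eqxx orbT.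
Qed.

Definition susp_rel :=
  EquivRel susp_glue susp_glue_refl susp_glue_sym susp_glue_trans.

Definition suspension : topologicalType :=
  quotient_topology {eq_quot susp_rel}.

End Suspension.

(** * Reduced simplicial homology with integer coefficients *)

Section Homology.
Variables (T : finType) (K : scomplex T).

(* Faces are indexed by cardinality, i.e. dimension plus one; [face 0] consists
   of the empty face, so that the complex below is the augmented one. *)
Definition face (n : nat) : finType :=
  {s : {set T} | (s \in faces K) && (#|s| == n)}.

Definition chain (n : nat) : zmodType := {ffun face n -> int}.

(* Faces are oriented by the enumeration order of [T]. *)
Definition position (s : {set T}) (x : T) : nat :=
  #|[set y in s | (enum_rank y < enum_rank x)%N]%SET|.

Definition incidence (s t : {set T}) : int :=
  \sum_(x in s | s :\ x == t) (-1) ^+ position s x.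

Definition boundary (n : nat) (c : chain n.+1) : chain n :=
  [ffun t => \sum_(s : face n.+1) incidence (val s) (val t) * c s].

Lemma boundary_is_zmod_morphism n : zmod_morphism (@boundary n).
Proof.
move=> c d; apply/ffunP => t; rewrite !ffunE -sumrB.
by apply: eq_bigr => s _; rewrite !ffunE mulrBr.
Qed.

HB.instance Definition _ n := GRing.isZmodMorphism.Build
  (chain n.+1) (chain n) (@boundary n) (@boundary_is_zmod_morphism n).

Variable k : nat.

Definition is_cycle : pred (chain k.+1) := [pred c | boundary c == 0].

Lemma is_cycle_zmod_closed : zmod_closed is_cycle.
Proof.
split=> [|c d]; rewrite !inE ?raddf0 // => /eqP c0 /eqP d0.
by rewrite raddfB /= c0 d0 subrr.
Qed.

HB.instance Definition _ :=
  GRing.isZmodClosed.Build (chain k.+1) is_cycle is_cycle_zmod_closed.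

Record cycle_group := Cycle { chain_of_cycle : chain k.+1;
                              _ : chain_of_cycle \in is_cycle }.

HB.instance Definition _ := [isSub for chain_of_cycle].
HB.instance Definition _ := [Choice of cycle_group by <:].
HB.instance Definition _ := [SubChoice_isSubZmodule of cycle_group by <:].

Definition is_boundary : pred cycle_group :=
  [pred z | `[< exists d : chain k.+2, boundary d = val z >]].

Lemma is_boundary_zmod_closed : zmod_closed is_boundary.
Proof.
split=> [|y z]; rewrite !unfold_in /=.
  by apply/asboolP; exists 0; rewrite !raddf0.
move=> /asboolP[c cy] /asboolP[d dz]; apply/asboolP.
by exists (c - d); rewrite !raddfB /= cy dz.
Qed.

HB.instance Definition _ :=
  GRing.isZmodClosed.Build cycle_group is_boundary is_boundary_zmod_closed.

Definition reduced_homology : zmodType :=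
  Quotient.quot (GRing.ZmodClosed.clone cycle_group is_boundary _).

End Homology.

Definition free_abelian (A : zmodType) : Prop :=
  exists (I : choiceType) (b : I -> A),
    (forall a : A, exists (s : {fset I}) (c : I -> int),
       a = \sum_(i <- s) b i *~ c i) /\
    (forall (s : {fset I}) (c : I -> int),
       \sum_(i <- s) b i *~ c i = 0 -> forall i, i \in s -> c i = 0).

(* Main.v *)
(* Let A be the star of v in I(H), and B the union over the edges e containing v
   of the stars of the simplices e \ v. A face s of I(H) that is not in A contains
   some e \ v, so I(H) is the union of A and B, and v is not a vertex of B.
   As v lies on no induced Berge triangle, if s together with e \ v is a face for
   each e in a family of edges containing v, then s together with all these e \ v
   is still a face. Hence the intersections of the stars making up B are
   again stars, so B is contractible like A, and I(H) is the suspension of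
   the intersection of A and B up to homotopy. That intersection is the
   independence complex of the hypergraph of its minimal nonfaces.

   The homotopies are explicit in barycentric coordinates: each is a
   concatenation of straight-line homotopies, after a truncation of small
   coordinates which pushes the points near a subcomplex into it. On the
   homology side, both A and B carry potentials, that is, 1-chains P(x) with
   [x, y] = P(y) - P(x) modulo boundaries on every edge xy; so a 1-cycle is
   determined modulo boundaries by finitely many integers, one for each
   connected component of the intersection of A and B, and the first homology
   embeds in a free abelian group of finite rank. *)

Require Import Defs.
From HB Require Import structures.
From mathcomp Require Import all_boot all_order all_algebra finmap.
From mathcomp Require Import generic_quotient ring_quotient.
From mathcomp Require Import all_classical all_reals all_analysis.
From mathcomp Require Import ring lra.

Set Implicit Arguments.
Unset Strict Implicit.
Unset Printing Implicit Defensive.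

Import Order.TTheory GRing.Theory Num.Theory.
Import numFieldNormedType.Exports.

Local Open Scope ring_scope.
Local Open Scope quotient_scope.

(** * Continuity of real-valued maps *)

(** The interiors of A and B need not cover I(H), so the room for deforming near a subcomplex has to
    be produced explicitly. Every map is a single formula on the ambient space of functions
    [T -> R], with denominators kept away from 0 by a maximum: continuity is then formal, and case
    distinctions occur only in locating the values. Where two pieces meet, the formula is the sum of
    both minus their common value, one of the two always being at rest. Instead of a nerve argument
    for B, a partition of unity sends each point straight into a simplex spanned by chosen vertices
    of the sets e \ v. The suspension is reached through a simplicial model with two extra vertices,
    which is compared with the topological suspension by a bijection from a compact to a Hausdorff
    space. The homology statement is not deduced from the homotopy equivalence: it reuses the two
    covers but works with chains only, so no homotopy invariance of homology is invoked. *)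

Section RealContinuity.
Variables (R : realType) (X : topologicalType).
Implicit Types f g : X -> R.

Lemma cts_add f g : continuous f -> continuous g ->
  continuous (fun x => f x + g x).
Proof. by move=> cf cg x; apply: continuousD; [exact: cf|exact: cg]. Qed.

Lemma cts_sub f g : continuous f -> continuous g ->
  continuous (fun x => f x - g x).
Proof. by move=> cf cg x; apply: continuousB; [exact: cf|exact: cg]. Qed.

Lemma cts_mul f g : continuous f -> continuous g ->
  continuous (fun x => f x * g x).
Proof. by move=> cf cg x; apply: continuousM; [exact: cf|exact: cg]. Qed.

Lemma cts_div f g : continuous f -> continuous g -> (forall x, g x != 0) ->
  continuous (fun x => f x / g x).
Proof.
move=> cf cg g0; apply: cts_mul => // x.
by apply: continuousV; [exact: g0|exact: cg].
Qed.

Lemma cts_max f g : continuous f -> continuous g ->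
  continuous (fun x => Num.max (f x) (g x)).
Proof. by move=> cf cg x; apply: continuous_max; [exact: cf|exact: cg]. Qed.

Lemma cts_min f g : continuous f -> continuous g ->
  continuous (fun x => Num.min (f x) (g x)).
Proof. by move=> cf cg x; apply: continuous_min; [exact: cf|exact: cg]. Qed.

Lemma cts_cst (c : R) : continuous (fun _ : X => c).
Proof. by move=> x; exact: cst_continuous. Qed.

Lemma cts_sum (I : Type) (r : seq I) (P : pred I) (f : I -> X -> R) :
  (forall i, continuous (f i)) -> continuous (fun x => \sum_(i <- r | P i) f i x).
Proof.
move=> cf; elim: r => [|i r IH].
  by under eq_fun do rewrite big_nil; exact: cts_cst.
under eq_fun do rewrite big_cons.
by case: (P i) => //; apply: cts_add.
Qed.

Lemma cts_prod (I : Type) (r : seq I) (P : pred I) (f : I -> X -> R) :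
  (forall i, continuous (f i)) -> continuous (fun x => \prod_(i <- r | P i) f i x).
Proof.
move=> cf; elim: r => [|i r IH].
  by under eq_fun do rewrite big_nil; exact: cts_cst.
under eq_fun do rewrite big_cons.
by case: (P i) => //; apply: cts_mul.
Qed.

End RealContinuity.

Lemma cts_comp (X Y Z : topologicalType) (f : X -> Y) (g : Y -> Z) :
  continuous f -> continuous g -> continuous (fun x => g (f x)).
Proof. by move=> cf cg x; apply: continuous_comp; [exact: cf|exact: cg]. Qed.

Lemma cts_ptws (X : topologicalType) (I : Type) (Y : topologicalType)
    (f : X -> {ptws I -> Y}) :
  (forall i, continuous (fun x => f x i)) -> continuous f.
Proof.
move=> cf x; suff: (f y @[y --> x] --> f x)%classic by [].
apply/(@cvg_sup _ _ _ (fmap f (nbhs x)) (f x)) => i A [_ [[B oB <-] Bx BA]].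
by apply: (filterS BA); apply: cf; exact: open_nbhs_nbhs.
Qed.

Lemma cts_coord (X : topologicalType) (I : eqType) (Y : topologicalType)
    (f : X -> {ptws I -> Y}) i :
  continuous f -> continuous (fun x => f x i).
Proof.
move=> cf; apply: (@cts_comp _ _ _ _ (fun h : {ptws I -> Y} => h i) cf).
exact: (@proj_continuous I (fun _ => Y) i).
Qed.

Lemma cts_val (X : topologicalType) (A : set X) : continuous (val : A -> X).
Proof. exact: initial_continuous. Qed.

Lemma cts_set_type (X Y : topologicalType) (A : set Y) (f : X -> A) :
  continuous (fun x => val (f x)) -> continuous f.
Proof. exact: (@continuous_comp_initial _ _ _ val f). Qed.

Lemma cts_pair (X Y Z : topologicalType) (f : X -> Y) (g : X -> Z) :
  continuous f -> continuous g -> continuous (fun x => (f x, g x)).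
Proof. by move=> cf cg x; apply: cvg_pair; [exact: cf|exact: cg]. Qed.

Lemma cts_fst (Y Z : topologicalType) : continuous (@fst Y Z).
Proof. by move=> x; exact: cvg_fst. Qed.
Lemma cts_snd (Y Z : topologicalType) : continuous (@snd Y Z).
Proof. by move=> x; exact: cvg_snd. Qed.

(** * Homotopies between maps into a realization *)

Section Barycentric.
Variable R : realType.
Implicit Types (T : finType) (s t : R).

(** Lets a path accept any real parameter: it rests before 0 and after 1, so concatenated paths need
    no case distinction in their formula. *)
Definition clamp s : R := Num.min 1 (Num.max 0 s).

Lemma clamp_ge0 s : 0 <= clamp s.
Proof. by rewrite /clamp le_min ler01 le_max lexx. Qed.

Lemma clamp_le1 s : clamp s <= 1.
Proof. by rewrite /clamp ge_min lexx. Qed.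

Lemma clamp_le0 s : s <= 0 -> clamp s = 0.
Proof. by move=> s0; rewrite /clamp max_l// min_r. Qed.

Lemma clamp_ge1 s : 1 <= s -> clamp s = 1.
Proof. by move=> s1; rewrite /clamp max_r ?min_l// (le_trans ler01). Qed.

Lemma clamp_id s : 0 <= s <= 1 -> clamp s = s.
Proof. by move=> /andP[s0 s1]; rewrite /clamp max_r// min_r. Qed.

Lemma cts_clamp (X : topologicalType) (f : X -> R) :
  continuous f -> continuous (fun x => clamp (f x)).
Proof.
by move=> cf; apply: cts_min; [exact: cts_cst|apply: cts_max => //; exact: cts_cst].
Qed.

Definition clamp_interval s : unit_interval R.
Proof.
exists (clamp s); apply/mem_set.
by rewrite /= in_itv /= clamp_ge0 clamp_le1.
Defined.

Definition time (t : unit_interval R) : R := val t.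

Lemma cts_time (X : topologicalType) (f : X -> unit_interval R) :
  continuous f -> continuous (fun x => time (f x)).
Proof. by move=> cf; apply: (cts_comp cf); exact: cts_val. Qed.

Lemma time_clamp_interval s : time (clamp_interval s) = clamp s.
Proof. by []. Qed.

Lemma cts_clamp_interval (X : topologicalType) (f : X -> R) :
  continuous f -> continuous (fun x => clamp_interval (f x)).
Proof. by move=> cf; apply: cts_set_type; exact: cts_clamp. Qed.

Lemma timeP (t : unit_interval R) : 0 <= time t <= 1.
Proof. by have := set_valP t; rewrite /= in_itv. Qed.

Definition barycentric T (x : T -> R) : Prop :=
  (forall i, 0 <= x i) /\ \sum_i x i = 1.

Definition support_set T (x : T -> R) : {set T} := [set i | x i != 0]%SET.

Lemma realization_setE T (K : scomplex T) (x : {ptws T -> R}) :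
  @realization_set R T K x <-> barycentric x /\ support_set x \in faces K.
Proof. by split=> [[? ? ?]|[[? ?] ?]]. Qed.

Definition point_of T (K : scomplex T) (x : realization R K) : {ptws T -> R} :=
  val x.

Lemma cts_point_of T (K : scomplex T) (X : topologicalType)
    (f : X -> realization R K) :
  continuous f -> continuous (fun x => point_of (f x)).
Proof. by move=> cf; apply: (cts_comp cf); exact: cts_val. Qed.

Lemma cts_point_coord T (K : scomplex T) (X : topologicalType)
    (f : X -> realization R K) i :
  continuous f -> continuous (fun x => point_of (f x) i).
Proof.
move=> cf.
exact: (@cts_coord X T R (fun x => point_of (f x)) i (cts_point_of cf)).
Qed.

Lemma point_of_inj T (K : scomplex T) : injective (@point_of T K).
Proof. exact: val_inj. Qed.

Lemma realizationP T (K : scomplex T) (x : realization R K) :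
  barycentric (point_of x) /\ support_set (point_of x) \in faces K.
Proof. by apply/realization_setE; exact: set_valP. Qed.

Definition to_realization T (K : scomplex T) (x : {ptws T -> R})
    (Kx : barycentric x /\ support_set x \in faces K) : realization R K :=
  exist _ x (mem_set ((realization_setE K x).2 Kx)).

Lemma point_of_to_realization T (K : scomplex T) (x : {ptws T -> R}) Kx :
  point_of (@to_realization T K x Kx) = x.
Proof. by []. Qed.

Lemma cts_to_realization T (K : scomplex T) (X : topologicalType)
    (f : X -> {ptws T -> R}) Kf :
  continuous f -> continuous (fun x => @to_realization T K (f x) (Kf x)).
Proof. by move=> cf; apply: cts_set_type. Qed.

Definition lerp T (x y : {ptws T -> R}) (t : R) : {ptws T -> R} :=
  fun i => x i + t * (y i - x i).

Lemma lerp0 T (x y : {ptws T -> R}) : lerp x y 0 = x.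
Proof. by apply/funext => i; rewrite /lerp mul0r addr0. Qed.

Lemma lerp1 T (x y : {ptws T -> R}) : lerp x y 1 = y.
Proof. by apply/funext => i; rewrite /lerp mul1r addrC subrK. Qed.

Lemma barycentric_lerp T (x y : {ptws T -> R}) t : 0 <= t <= 1 ->
  barycentric x -> barycentric y -> barycentric (lerp x y t).
Proof.
move=> /andP[t0 t1] [x0 x1] [y0 y1]; split => [i|].
  have := mulr_ge0 t0 (y0 i).
  have : 0 <= (1 - t) * x i by rewrite mulr_ge0// subr_ge0.
  rewrite /lerp; lra.
by rewrite /lerp big_split/= -mulr_sumr sumrB x1 y1 subrr mulr0 addr0.
Qed.

Lemma support_lerp T (x y : {ptws T -> R}) t :
  support_set (lerp x y t) \subset support_set x :|: support_set y.
Proof.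
apply/fintype.subsetP => i; rewrite !inE; apply: contraR.
rewrite negb_or !negbK /lerp => /andP[/eqP-> /eqP->].
by rewrite subrr mulr0 addr0.
Qed.

Lemma realization_lerp T (K : scomplex T) (x y : {ptws T -> R}) t :
  0 <= t <= 1 -> barycentric x -> barycentric y ->
  support_set x :|: support_set y \in faces K ->
  barycentric (lerp x y t) /\ support_set (lerp x y t) \in faces K.
Proof.
move=> t01 bx bY fxy; split; first exact: barycentric_lerp.
exact: faces_closed fxy (support_lerp _ _ _).
Qed.

Lemma cts_lerp (X : topologicalType) T (f g : X -> {ptws T -> R}) (s : X -> R) :
  continuous f -> continuous g -> continuous s ->
  continuous (fun x => lerp (f x) (g x) (s x)).
Proof.
move=> cf cg cs; apply: cts_ptws => i; apply: cts_add; first exact: cts_coord.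
by apply: cts_mul => //; apply: cts_sub; exact: cts_coord.
Qed.

(** Contiguous maps: both values lie in one closed simplex, which contains the segment between
    them. *)
Lemma homotopic_lerp T (K : scomplex T) (X : topologicalType)
    (f g : X -> realization R K) : continuous f -> continuous g ->
  (forall x, support_set (point_of (f x)) :|: support_set (point_of (g x)) \in faces K) ->
  homotopic R f g.
Proof.
move=> cf cg fg.
pose F (p : X * unit_interval R) := to_realization
  (realization_lerp (timeP p.2) (realizationP (f p.1)).1
     (realizationP (g p.1)).1 (fg p.1)).
exists F; split.
  apply: cts_to_realization; apply: cts_lerp.
  - by apply: cts_point_of; apply: (cts_comp _ cf); exact: cts_fst.
  - by apply: cts_point_of; apply: (cts_comp _ cg); exact: cts_fst.
  - by apply: cts_time; exact: cts_snd.
move=> x t; rewrite -/(time t); split=> t01; apply: point_of_inj;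
  rewrite point_of_to_realization /=.
  by rewrite t01 lerp0.
by rewrite t01 lerp1.
Qed.

(* The glued homotopy [F] then [G] is written as the coordinatewise sum
   [F + G - F(_, 1)], which makes its continuity immediate. *)
Lemma homotopic_trans T (K : scomplex T) (X : topologicalType)
    (f g h : X -> realization R K) :
  homotopic R f g -> homotopic R g h -> homotopic R f h.
Proof.
move=> [F [cF Ffg]] [G [cG Ggh]].
pose first_half (t : R) := clamp_interval (2 * t).
pose second_half (t : R) := clamp_interval (2 * t - 1).
pose H0 (p : X * unit_interval R) : {ptws T -> R} := fun i =>
  point_of (F (p.1, first_half (time p.2))) i +
  point_of (G (p.1, second_half (time p.2))) i - point_of (g p.1) i.
have gF x (t : R) : 1 <= t -> F (x, clamp_interval t) = g x.
  by move=> t1; apply: (Ffg _ _).2; rewrite -/(time _) time_clamp_interval clamp_ge1.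
have gG x (t : R) : t <= 0 -> G (x, clamp_interval t) = g x.
  by move=> t1; apply: (Ggh _ _).1; rewrite -/(time _) time_clamp_interval clamp_le0.
have H0E p : exists y : realization R K, H0 p = point_of y.
  case: p => x t; case: (leP (time t) (1 / 2)) => th.
    exists (F (x, first_half (time t))); apply/funext => i; rewrite /H0/=.
    by rewrite gG ?addrK//; lra.
  exists (G (x, second_half (time t))); apply/funext => i; rewrite /H0/=.
  by rewrite gF 1?addrC ?addKr//; lra.
have H0P p : barycentric (H0 p) /\ support_set (H0 p) \in faces K.
  by have [y ->] := H0E p; exact: realizationP.
(* As the final stage of [F], the map [g] inherits its continuity. *)
have cg : continuous g.
  have -> : g = fun x => F (x, clamp_interval 1).
    by apply/funext => x; rewrite gF.
  apply: (cts_comp _ cF); apply: cts_pair; first by move=> ?; exact: cvg_id.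
  by apply: cts_clamp_interval; exact: cts_cst.
have c2 : continuous (fun p : X * unit_interval R => 2 * time p.2).
  apply: cts_mul; first exact: cts_cst.
  by apply: cts_time; exact: cts_snd.
exists (fun p => to_realization (H0P p)); split.
  apply: cts_to_realization; apply: cts_ptws => i.
  apply: cts_sub; last first.
    by apply: cts_point_coord; apply: (cts_comp _ cg); exact: cts_fst.
  apply: cts_add; apply: cts_point_coord.
    apply: (cts_comp _ cF); apply: cts_pair; first exact: cts_fst.
    exact: cts_clamp_interval.
  apply: (cts_comp _ cG); apply: cts_pair; first exact: cts_fst.
  by apply: cts_clamp_interval; apply: cts_sub => //; exact: cts_cst.
move=> x t; rewrite -/(time t); split=> t01; apply: point_of_inj;
  rewrite point_of_to_realization /=; apply/funext => i;
  rewrite /H0/= /first_half /second_half t01.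
  rewrite gG ?addrK; last lra.
  by rewrite (Ffg _ _).1// -/(time _) time_clamp_interval clamp_le0//; lra.
rewrite gF 1?addrC ?addKr; last lra.
by rewrite (Ggh _ _).2// -/(time _) time_clamp_interval clamp_ge1//; lra.
Qed.

End Barycentric.

(** * Contracting a subcomplex covered by compatible cones *)

Definition downclosed (T : finType) (D : {set {set T}}) : Prop :=
  forall s t : {set T}, s \in D -> t \subset s -> t \in D.

(* [D a] plays the role of a subcomplex of [B] that can be coned off from the
   vertex [a]; the last condition makes these coning operations compatible and
   forces [B] to be contractible. *)
Record cone_cover (T : finType) (B : {set {set T}}) (D : T -> {set {set T}}) :
    Prop := ConeCover {
  cover_down : forall a, downclosed (D a);
  coverP : forall s, s \in B <-> exists a, s \in D a;
  cover_join : forall s I : {set T}, I != finset.set0 ->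
    (forall a, a \in I -> s \in D a) -> s :|: I \in B }.

Lemma cone_cover_down (T : finType) (B : {set {set T}}) D :
  cone_cover B D -> downclosed B.
Proof.
move=> cB s t /(coverP cB)[a sa] ts; apply/(coverP cB).
by exists a; exact: (cover_down cB) sa ts.
Qed.

Section Contraction.
Variables (R : realType) (T : finType).
Local Notation M := {ptws T -> R}.
Implicit Types (x : M) (D : {set {set T}}).

(** With this constant, lowering all coordinates of a barycentric point by [eps] leaves a total of
    at least [1 - #|T| * eps = eps]; this bounds [excess] below and makes the normalization in
    [trunc] harmless. *)
Definition eps : R := #|T|.+1%:R^-1.

Lemma eps_gt0 : 0 < eps.
Proof. by rewrite /eps invr_gt0. Qed.

Lemma eps_le1 : eps <= 1.
Proof. by rewrite /eps invf_le1// ler1n. Qed.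

Definition excess x : R := \sum_j Num.max 0 (x j - eps).

(* The outer [max] only makes the denominator positive off the simplex. *)
Definition trunc x : M := fun i => Num.max 0 (x i - eps) / Num.max eps (excess x).

Lemma trunc_den_gt0 x : 0 < Num.max eps (excess x).
Proof. by rewrite lt_max eps_gt0. Qed.

Lemma excess_ge x : barycentric x -> eps <= excess x.
Proof.
move=> [x0 x1]; apply: (@le_trans _ _ (\sum_j (x j - eps))).
  rewrite sumrB x1 sumr_const.
  have : #|T|.+1%:R * eps = 1 by rewrite /eps mulfV// pnatr_eq0.
  by rewrite -natr1 mulrDl mul1r mulr_natl; lra.
by apply: ler_sum => j _; rewrite le_max lexx orbT.
Qed.

Lemma barycentric_trunc x : barycentric x -> barycentric (trunc x).
Proof.
move=> bx; split => [i|].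
  by rewrite /trunc divr_ge0// ?le_max ?lexx// ltW// eps_gt0.
rewrite -mulr_suml max_r ?excess_ge// divff// gt_eqF//.
exact: lt_le_trans eps_gt0 (excess_ge bx).
Qed.

Lemma support_trunc x : support_set (trunc x) = [set i | eps < x i]%SET.
Proof.
apply/finset.setP => i; rewrite !inE /trunc mulf_eq0 invr_eq0 (gt_eqF (trunc_den_gt0 x)).
rewrite orbF -subr_gt0; case: (ltP 0 (x i - eps)) => h; last by rewrite eqxx.
by rewrite gt_eqF.
Qed.

Lemma support_trunc_sub x : support_set (trunc x) \subset support_set x.
Proof.
rewrite support_trunc; apply/fintype.subsetP => i; rewrite !inE => xi.
by rewrite gt_eqF// (lt_trans eps_gt0).
Qed.

Lemma cts_trunc (X : topologicalType) (f : X -> M) :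
  continuous f -> continuous (fun p => trunc (f p)).
Proof.
move=> cf; apply: cts_ptws => i; apply: cts_div.
- apply: cts_max; first exact: cts_cst.
  by apply: cts_sub; [exact: cts_coord|exact: cts_cst].
- apply: cts_max; first exact: cts_cst.
  apply: cts_sum => j; apply: cts_max; first exact: cts_cst.
  by apply: cts_sub; [exact: cts_coord|exact: cts_cst].
- by move=> p; rewrite gt_eqF// trunc_den_gt0.
Qed.

(* If truncation keeps every vertex of a nonface [s] of [D], then the product
   over [s] is at least [eps ^+ #|T|]; so [far D x < 1] puts [trunc x] in [D]. *)
Definition far D x : R :=
  Num.min 1 ((\sum_(s | s \notin D) \prod_(i in s) x i) / eps ^+ #|T|).

Lemma cts_far D (X : topologicalType) (f : X -> M) :
  continuous f -> continuous (fun p => far D (f p)).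
Proof.
move=> cf; apply: cts_min; first exact: cts_cst.
apply: cts_mul; last exact: cts_cst.
by apply: cts_sum => s; apply: cts_prod => i; exact: cts_coord.
Qed.

Lemma far_le1 D x : far D x <= 1.
Proof. by rewrite /far ge_min lexx. Qed.

Lemma far_ge0 D x : barycentric x -> 0 <= far D x.
Proof.
move=> [x0 _]; rewrite /far le_min ler01 divr_ge0// ?exprn_ge0 ?(ltW eps_gt0)//.
by apply: sumr_ge0 => s _; apply: prodr_ge0 => i _.
Qed.

Lemma far_eq0 D x : downclosed D -> support_set x \in D -> far D x = 0.
Proof.
move=> dD xD; rewrite /far big1 ?mul0r ?min_r// => s sD.
have /subsetPn[i si] : ~~ (s \subset support_set x).
  by apply: contra sD => /(dD _ _ xD).
rewrite inE negbK => /eqP xi.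
by rewrite (bigD1 i)//= xi mul0r.
Qed.

Lemma far_lt1 D x : barycentric x -> far D x < 1 ->
  support_set (trunc x) \in D.
Proof.
move=> [x0 _]; rewrite support_trunc; set s := [set i | _]%SET.
apply: contraTT => sD; rewrite -leNgt /far le_min lexx /=.
rewrite ler_pdivlMr ?exprn_gt0 ?eps_gt0// mul1r (bigD1 s)//=.
apply: (@le_trans _ _ (\prod_(i in s) x i)); last first.
  rewrite lerDl; apply: sumr_ge0 => t _; exact: prodr_ge0.
apply: (@le_trans _ _ (\prod_(i in s) eps)).
  rewrite prodr_const ler_wiXn2l ?eps_le1 ?(ltW eps_gt0)//.
  exact: max_card.
apply: ler_prod => i; rewrite inE => /ltW ->.
by rewrite (ltW eps_gt0).
Qed.

Variables (B : {set {set T}}) (D : T -> {set {set T}}).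

(** A partition of unity subordinate to the neighbourhoods [far (D a) x < 1], read as a point with
    the apexes [a] as vertices. On [B] some summand is 1, so the maximum acts only off [B]. *)
Definition cover_map x : M := fun a =>
  (1 - far (D a) x) / Num.max 1 (\sum_b (1 - far (D b) x)).

Lemma cover_map_den_gt0 x : 0 < Num.max 1 (\sum_b (1 - far (D b) x)).
Proof. by rewrite lt_max ltr01. Qed.

Lemma cts_cover_map (X : topologicalType) (f : X -> M) :
  continuous f -> continuous (fun p => cover_map (f p)).
Proof.
move=> cf; apply: cts_ptws => i; apply: cts_div.
- by apply: cts_sub; [exact: cts_cst|exact: cts_far].
- apply: cts_max; first exact: cts_cst.
  by apply: cts_sum => j; apply: cts_sub; [exact: cts_cst|exact: cts_far].
- by move=> p; rewrite gt_eqF// cover_map_den_gt0.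
Qed.

Definition vertex_point (a : T) : M := fun i => (i == a)%:R.

Lemma barycentric_vertex a : barycentric (vertex_point a).
Proof.
split=> [i|]; first by rewrite ler0n.
rewrite (bigD1 a)//= big1 ?addr0 /vertex_point ?eqxx// => i.
by move=> /negbTE ->.
Qed.

Lemma support_vertex a : support_set (vertex_point a) = [set a]%SET.
Proof.
apply/finset.setP => i; rewrite !inE /vertex_point.
by case: (i == a); rewrite ?oner_eq0 ?eqxx.
Qed.

(** The detour through [trunc x] is needed because an apex in the support of [cover_map x] is only
    known to have [trunc x], not [x], in its [D a]; [cover_join] then applies to the second leg.
    Each leg takes a third of the time. *)
Definition cover_contraction a0 x (s : R) : M :=
  lerp (lerp (lerp x (trunc x) (clamp (3 * s))) (cover_map x)
    (clamp (3 * s - 1))) (vertex_point a0) (clamp (3 * s - 2)).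

Lemma cover_contraction_le0 a0 x s : s <= 0 -> cover_contraction a0 x s = x.
Proof. by move=> s0; rewrite /cover_contraction !clamp_le0 ?lerp0//; lra. Qed.

Lemma cover_contraction_ge1 a0 x s : 1 <= s -> cover_contraction a0 x s = vertex_point a0.
Proof.
move=> s0; rewrite /cover_contraction [clamp (3 * s - 2)]clamp_ge1 ?lerp1//; lra.
Qed.

Lemma cts_cover_contraction a0 (X : topologicalType) (f : X -> M) (s : X -> R) :
  continuous f -> continuous s -> continuous (fun p => cover_contraction a0 (f p) (s p)).
Proof.
move=> cf cs; have c3 : continuous (fun p => 3 * s p).
  by apply: cts_mul => //; exact: cts_cst.
apply: cts_lerp; [apply: cts_lerp; [apply: cts_lerp => //|..]|..].
- exact: cts_trunc.
- exact: cts_clamp.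
- exact: cts_cover_map.
- by apply: cts_clamp; apply: cts_sub => //; exact: cts_cst.
- by apply: cts_ptws => i; exact: cts_cst.
- by apply: cts_clamp; apply: cts_sub => //; exact: cts_cst.
Qed.

Hypothesis cB : cone_cover B D.

Lemma support_cover_map x a : barycentric x ->
  a \in support_set (cover_map x) -> support_set (trunc x) \in D a.
Proof.
move=> bx; rewrite inE /cover_map mulf_eq0 invr_eq0 (gt_eqF (cover_map_den_gt0 x)).
rewrite orbF subr_eq0 eq_sym => fx; apply: far_lt1 => //.
by rewrite lt_neqAle fx far_le1.
Qed.

Lemma barycentric_cover_map x : barycentric x -> support_set x \in B ->
  barycentric (cover_map x).
Proof.
move=> bx xB; split => [a|].
  by rewrite divr_ge0// ?subr_ge0 ?far_le1// le_max ler01.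
have ge1 : 1 <= \sum_b (1 - far (D b) x).
  move: xB => /(proj1 (coverP cB _))[a xa].
  rewrite (bigD1 a)//= far_eq0//; last exact: cover_down cB a.
  by rewrite subr0 lerDl; apply: sumr_ge0 => b _; rewrite subr_ge0 far_le1.
by rewrite -mulr_suml max_r// divff// gt_eqF// (lt_le_trans ltr01).
Qed.

Lemma barycentric_support_neq0 x : barycentric x -> support_set x != finset.set0.
Proof.
move=> [_ x1]; apply/eqP => x0; move: x1; rewrite big1 => [/eqP|i _].
  by rewrite eq_sym oner_eq0.
by apply/eqP; move/finset.setP/(_ i): x0; rewrite !inE => /negbFE.
Qed.

Lemma cover_contractionP a0 x s : finset.set0 \in D a0 -> barycentric x ->
  support_set x \in B ->
  barycentric (cover_contraction a0 x s) /\ support_set (cover_contraction a0 x s) \in B.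
Proof.
move=> Da0 bx xB; have dB := cone_cover_down cB.
pose K := SComplex dB.
have bp := barycentric_cover_map bx xB.
rewrite /cover_contraction; have [s1|s1] := leP (3 * s) 1.
  rewrite [clamp (3 * s - 1)]clamp_le0 ?[clamp (3 * s - 2)]clamp_le0; try lra.
  rewrite !lerp0; apply: (@realization_lerp _ _ K) => //.
  - by rewrite clamp_ge0 clamp_le1.
  - exact: barycentric_trunc.
  - by rewrite (finset.setUidPl (support_trunc_sub x)).
rewrite clamp_ge1 ?lerp1; last lra.
have [s2|s2] := leP (3 * s) 2.
  rewrite [clamp (3 * s - 2)]clamp_le0 ?lerp0; last lra.
  apply: (@realization_lerp _ _ K) => //.
  - by rewrite clamp_ge0 clamp_le1.
  - exact: barycentric_trunc.
  - apply: (cover_join cB); first exact: barycentric_support_neq0.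
    by move=> a; exact: support_cover_map.
rewrite [clamp (3 * s - 1)]clamp_ge1 ?lerp1; last lra.
apply: (@realization_lerp _ _ K) => //.
- by rewrite clamp_ge0 clamp_le1.
- exact: barycentric_vertex.
(* For the last leg, [cover_join] with the empty face shows that all apexes in use span a face
   together with [a0]. *)
- rewrite -[_ :|: _]finset.set0U; apply: (cover_join cB).
    rewrite -cards_eq0 -lt0n (leq_trans _ (subset_leq_card (finset.subsetUr _ _)))//.
    by rewrite support_vertex cards1.
  move=> a; rewrite support_vertex => /finset.setUP[|/finset.set1P -> //].
  move=> /(support_cover_map bx) xa.
  by apply: (cover_down cB) xa _; exact: finset.sub0set.
Qed.

End Contraction.

(** * The union of two contractible subcomplexes *)

Section SuspensionComplex.
Variables (T : finType) (L : scomplex T).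

Definition base_part (s : {set T + bool}) : {set T} := [set i | inl i \in s]%SET.

(** A simplicial model of the suspension with poles [inr true] and [inr false]: the pole coordinates
    of a point measure its height, so maps to and from it can be written in barycentric
    coordinates. *)
Definition suspension_faces : {set {set T + bool}} :=
  [set s : {set T + bool} | (base_part s \in faces L) &&
     ~~ ((inr true \in s) && (inr false \in s))]%SET.

Lemma suspension_faces_closed (s t : {set T + bool}) :
  s \in suspension_faces -> t \subset s -> t \in suspension_faces.
Proof.
rewrite !inE => /andP[sL sp] /fintype.subsetP ts; apply/andP; split.
  by apply: (faces_closed sL); apply/fintype.subsetP => i; rewrite !inE; exact: ts.
by apply: contra sp => /andP[/ts -> /ts ->].
Qed.

Definition suspension_complex : scomplex (T + bool)%type :=
  SComplex suspension_faces_closed.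

Definition cone_face (b : bool) (t : {set T}) : {set T + bool} :=
  [set k : T + bool | match k with inl i => i \in t | inr c => c == b end]%SET.

Lemma cone_faceP b (t : {set T}) (s : {set T + bool}) :
  t \in faces L -> s \subset cone_face b t -> s \in faces suspension_complex.
Proof.
move=> tL; apply: suspension_faces_closed; rewrite !inE; apply/andP; split.
  by rewrite (_ : base_part _ = t)//; apply/finset.setP => i; rewrite !inE.
by case: b.
Qed.

End SuspensionComplex.

(** * Comparison of the union with the simplicial suspension of the intersection *)

Section TwoCones.
Variables (R : realType) (T : finType) (K L : scomplex T).
Variables (C : bool -> {set {set T}}) (D : bool -> T -> {set {set T}}).
Variable apex : bool -> T.
Hypothesis coverC : forall b, cone_cover (C b) (D b).
Hypothesis apexD : forall b, finset.set0 \in D b (apex b).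
Hypothesis facesK : forall s, s \in faces K <-> exists b, s \in C b.
Hypothesis facesL : forall s, s \in faces L <-> forall b, s \in C b.
Local Notation M := {ptws T -> R}.
Local Notation S := (suspension_complex L).
Local Notation N := {ptws (T + bool)%type -> R}.

Let downC b : downclosed (C b).
Proof. exact: cone_cover_down (coverC b). Qed.

Let set0L : finset.set0 \in faces L.
Proof.
by apply/facesL => b; apply/(coverP (coverC b)); exists (apex b); exact: apexD.
Qed.

Let apexC b : [set apex b]%SET \in C b.
Proof.
rewrite -[X in X \in _]finset.set0U; apply: (cover_join (coverC b)).
  by rewrite -cards_eq0 cards1.
by move=> a /finset.set1P ->; exact: apexD.
Qed.

Definition cone_contraction b (x : M) (s : R) : M := cover_contraction (D b) (apex b) x s.

Lemma cone_contractionP b (x : M) s : barycentric x -> support_set x \in C b ->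
  barycentric (cone_contraction b x s) /\
  support_set (cone_contraction b x s) \in C b.
Proof. exact: cover_contractionP. Qed.

(* At most one of the two distances is nonzero, and [trunc x] lies in [L]
   unless one of them is [1]. *)
Definition to_suspension (x : M) : N := fun k =>
  match k with
  | inl i => (1 - far (C true) x - far (C false) x) * trunc x i
  | inr b => far (C (~~ b)) x
  end.

(** The projection from a pole to the base, normalized as long as the pole coordinate is at most
    2/3. Nearer to the pole the bound 1/3 only keeps the quotient continuous: there [of_suspension]
    already rests at the apex. *)
Definition base_point (y : N) : M := fun i =>
  y (inl i) / Num.max (1 / 3) (1 - y (inr true) - y (inr false)).

(* On the simplices through the pole [b] the other contraction is the identity,
   so that this sum is [cone_contraction b (base_point y) (3 * y (inr b) - 1)]. *)
Definition of_suspension (y : N) : M := fun i =>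
  cone_contraction true (base_point y) (3 * y (inr true) - 1) i +
  cone_contraction false (base_point y) (3 * y (inr false) - 1) i -
  base_point y i.

Lemma cts_to_suspension (X : topologicalType) (f : X -> M) :
  continuous f -> continuous (fun p => to_suspension (f p)).
Proof.
move=> cf; apply: cts_ptws => -[i|b]; last exact: cts_far.
apply: cts_mul; last exact: (@cts_coord X T R (fun p => trunc (f p)) i (cts_trunc cf)).
apply: cts_sub; last exact: cts_far.
by apply: cts_sub; [exact: cts_cst|exact: cts_far].
Qed.

Lemma cts_base_point (X : topologicalType) (f : X -> N) :
  continuous f -> continuous (fun p => base_point (f p)).
Proof.
move=> cf; apply: cts_ptws => i; apply: cts_div.
- exact: (@cts_coord X (T + bool)%type R f (inl i) cf).
- apply: cts_max; first exact: cts_cst.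
  apply: cts_sub; last exact: (@cts_coord X (T + bool)%type R f (inr false) cf).
  apply: cts_sub; first exact: cts_cst.
  exact: (@cts_coord X (T + bool)%type R f (inr true) cf).
- by move=> p; rewrite gt_eqF// lt_max; apply/orP; left; lra.
Qed.

Lemma cts_of_suspension (X : topologicalType) (f : X -> N) :
  continuous f -> continuous (fun p => of_suspension (f p)).
Proof.
move=> cf; have cb := cts_base_point cf.
have cc b i : continuous (fun p =>
    cone_contraction b (base_point (f p)) (3 * f p (inr b) - 1) i).
  apply: (@cts_coord X T R (fun p => cone_contraction b _ _)).
  apply: cts_cover_contraction => //; apply: cts_sub; last exact: cts_cst.
  apply: cts_mul; first exact: cts_cst.
  exact: (@cts_coord X (T + bool)%type R f (inr b) cf).
apply: cts_ptws => i; apply: cts_sub; first exact: cts_add.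
exact: (@cts_coord X T R (fun p => base_point (f p)) i cb).
Qed.

Lemma to_suspensionP (x : M) : barycentric x -> support_set x \in faces K ->
  barycentric (to_suspension x) /\
  support_set (to_suspension x) \in faces S.
Proof.
move=> bx /facesK[b xb]; have f0 := far_eq0 (@downC b) xb.
have [t0 t1] := barycentric_trunc bx.
have E : 1 - far (C true) x - far (C false) x = 1 - far (C (~~ b)) x.
  by move: f0; case: (b) => /= ->; rewrite ?subr0 // addrAC subr0.
split; first split.
- case=> [i|c]; last exact: far_ge0.
  by rewrite /to_suspension E mulr_ge0// subr_ge0 far_le1.
- rewrite big_sumType/= -mulr_sumr t1 big_bool/=.
  by move: f0; case: (b) => /= ->; lra.
- apply: (@cone_faceP _ _ b (base_part (support_set (to_suspension x)))); last first.
    apply/fintype.subsetP => -[i|c]; rewrite !inE//=.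
    by apply: contra_neqT; case: c; case: (b) f0 => /=.
  have [f1|f1] := eqVneq (far (C (~~ b)) x) 1.
    rewrite (_ : base_part _ = finset.set0)//; apply/finset.setP => i.
    by rewrite !inE/= E f1 subrr mul0r eqxx.
  have f2 : far (C (~~ b)) x < 1 by rewrite lt_neqAle f1 far_le1.
  have tb : support_set (trunc x) \in faces L.
    apply/facesL => c; have [->|/negPf cb] := eqVneq c b.
      by apply: downC xb (support_trunc_sub x).
    have -> : c = ~~ b by case: c cb; case: (b).
    exact: far_lt1.
  apply: (faces_closed tb); apply/fintype.subsetP => i; rewrite !inE/=.
  by rewrite mulf_eq0 negb_or => /andP[].
Qed.

Section Point.
Variables (y : N) (b : bool).
Hypothesis by_ : barycentric y.
Hypothesis yS : support_set y \in faces S.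
Hypothesis yb : y (inr (~~ b)) = 0.

Lemma pole_sum : 1 - y (inr true) - y (inr false) = 1 - y (inr b).
Proof. by move: yb; case: (b) => /= ->; rewrite ?subr0// addrAC subr0. Qed.

Lemma base_sum : \sum_i y (inl i) = 1 - y (inr b).
Proof.
have [_] := by_; rewrite big_sumType/= big_bool/= => <-.
by move: yb; case: (b) => /= ->; rewrite ?addr0 ?add0r addrK.
Qed.

Lemma base_partL : base_part (support_set y) \in faces L.
Proof. by move: yS; rewrite inE => /andP[]. Qed.

Lemma base_pointP : y (inr b) <= 2 / 3 -> barycentric (base_point y).
Proof.
move=> h; have h3 : 1 / 3 <= 1 - y (inr b) by lra.
split=> [i|].
  rewrite /base_point divr_ge0 ?by_.1// le_max; apply/orP; left; lra.
rewrite -mulr_suml base_sum pole_sum max_r// divff//.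
rewrite gt_eqF//; lra.
Qed.

Lemma support_base_point : support_set (base_point y) = base_part (support_set y).
Proof.
apply/finset.setP => i; rewrite !inE /base_point mulf_eq0 invr_eq0.
rewrite [X in _ || X]gt_eqF ?orbF// lt_max; apply/orP; left; lra.
Qed.

Lemma of_suspensionE : of_suspension y =
  cone_contraction b (base_point y) (3 * y (inr b) - 1).
Proof.
apply/funext => i; rewrite /of_suspension.
have c0 : cone_contraction (~~ b) (base_point y) (3 * y (inr (~~ b)) - 1) =
          base_point y.
  by rewrite /cone_contraction cover_contraction_le0// yb; lra.
by move: c0; case: (b) => /= ->; rewrite ?addrK// addrAC addrN add0r.
Qed.

Lemma of_suspensionP : barycentric (of_suspension y) /\
  support_set (of_suspension y) \in C b.
Proof.
rewrite of_suspensionE; have [h|h] := leP (y (inr b)) (2 / 3).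
  apply: cone_contractionP; first exact: base_pointP.
  by rewrite support_base_point; apply: (facesL _).1; exact: base_partL.
rewrite /cone_contraction cover_contraction_ge1; last lra.
split; first exact: barycentric_vertex.
by rewrite support_vertex; exact: apexC.
Qed.

End Point.

Lemma suspension_pole (y : N) : support_set y \in faces S ->
  exists b, y (inr (~~ b)) = 0.
Proof.
rewrite inE => /andP[_]; rewrite negb_and !inE !negbK => /orP[] /eqP y0.
  by exists false.
by exists true.
Qed.

Lemma of_suspensionK (y : N) : barycentric y -> support_set y \in faces S ->
  barycentric (of_suspension y) /\ support_set (of_suspension y) \in faces K.
Proof.
move=> bY yS; have [b yb] := suspension_pole yS.
have [? ?] := of_suspensionP bY yS yb.
by split => //; apply/facesK; exists b.
Qed.

Definition toS (x : realization R K) : realization R S :=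
  to_realization (to_suspensionP (realizationP x).1 (realizationP x).2).

Definition ofS (y : realization R S) : realization R K :=
  to_realization (of_suspensionK (realizationP y).1 (realizationP y).2).

Lemma cts_toS : continuous toS.
Proof.
apply: cts_to_realization; apply: cts_to_suspension; apply: cts_point_of.
by move=> x; exact: cvg_id.
Qed.

Lemma cts_ofS : continuous ofS.
Proof.
apply: cts_to_realization; apply: cts_of_suspension; apply: cts_point_of.
by move=> x; exact: cvg_id.
Qed.

Lemma trunc_realization (x : M) : barycentric x -> support_set x \in faces K ->
  barycentric (trunc x) /\ support_set (trunc x) \in faces K.
Proof.
move=> bx xK; split; first exact: barycentric_trunc.
exact: faces_closed xK (support_trunc_sub x).
Qed.

(** The factor [u] scales the contraction time: [u = 1] gives [of_suspension (to_suspension x)] and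
    [u = 0] gives [trunc x]. On a face in [C b] the distance to [C b] is 0, so the other contraction
    has time [- u] and rests. *)
Definition cone_path (x : M) (u : R) : M := fun i =>
  cone_contraction true (trunc x) (u * (3 * far (C false) x - 1)) i +
  cone_contraction false (trunc x) (u * (3 * far (C true) x - 1)) i - trunc x i.

Lemma cone_pathE b (x : M) u : support_set x \in C b -> 0 <= u ->
  cone_path x u =
  cone_contraction b (trunc x) (u * (3 * far (C (~~ b)) x - 1)).
Proof.
move=> xb u0; have f0 := far_eq0 (@downC b) xb; apply/funext => i.
have c0 : cone_contraction (~~ b) (trunc x) (u * (3 * far (C b) x - 1)) = trunc x.
  by rewrite /cone_contraction cover_contraction_le0// f0; lra.
rewrite /cone_path.
by move: c0; case: (b) => /= ->; rewrite ?addrK// addrAC addrN add0r.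
Qed.

Lemma cone_pathP (x : M) u : barycentric x -> support_set x \in faces K ->
  0 <= u -> barycentric (cone_path x u) /\ support_set (cone_path x u) \in faces K.
Proof.
move=> bx /facesK[b xb] u0; rewrite (cone_pathE xb u0).
have [? ?] : barycentric (cone_contraction b (trunc x) (u * (3 * far (C (~~ b)) x - 1)))
  /\ support_set (cone_contraction b (trunc x) (u * (3 * far (C (~~ b)) x - 1))) \in C b.
  apply: cone_contractionP; first exact: barycentric_trunc.
  by apply: (@downC b) xb _; exact: support_trunc_sub.
by split => //; apply/facesK; exists b.
Qed.

Lemma of_to_suspension (x : M) : support_set x \in faces K ->
  barycentric x -> of_suspension (to_suspension x) = cone_path x 1.
Proof.
move=> /facesK[b xb] bx; have f0 := far_eq0 (@downC b) xb.
have yb : to_suspension x (inr (~~ b)) = 0 by rewrite /= negbK.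
rewrite (of_suspensionE yb) (cone_pathE xb ler01) mul1r /=.
(* Beyond 2/3 both contractions have ended at the apex; below, normalizing cancels the factor
   [1 - far], and the base point is [trunc x]. *)
have [h|h] := leP (far (C (~~ b)) x) (2 / 3); last first.
  by rewrite /cone_contraction !cover_contraction_ge1//; lra.
congr (cone_contraction b _ _); apply/funext => i.
rewrite /base_point (pole_sum yb)/= max_r; last lra.
have -> : 1 - far (C true) x - far (C false) x = 1 - far (C (~~ b)) x.
  by move: f0; case: (b) => /= ->; rewrite ?subr0 // addrAC subr0.
by rewrite mulrC mulKf// gt_eqF//; lra.
Qed.

(** Running [cone_path] backwards removes the contraction and leaves truncation, which is contiguous
    to the identity. *)
Lemma ofS_toS_homotopic : homotopic R (ofS \o toS) idfun.
Proof.
pose tr (x : realization R K) := to_realization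
  (trunc_realization (realizationP x).1 (realizationP x).2).
have ctr : continuous tr.
  apply: cts_to_realization; apply: cts_trunc; apply: cts_point_of.
  by move=> x; exact: cvg_id.
apply: (@homotopic_trans _ _ _ _ _ tr); last first.
  apply: homotopic_lerp => //; first by move=> x; exact: cvg_id.
  move=> x; rewrite point_of_to_realization.
  by rewrite (finset.setUidPr (support_trunc_sub _)) (realizationP x).2.
have u0 (t : unit_interval R) : 0 <= 1 - time t.
  by have := timeP t; lra.
pose F (p : realization R K * unit_interval R) := to_realization
  (cone_pathP (realizationP p.1).1 (realizationP p.1).2 (u0 p.2)).
exists F; split; last first.
  move=> x t; rewrite -/(time t); split=> ht; apply: point_of_inj;
    rewrite !point_of_to_realization/= ht ?subr0 ?subrr.
    by rewrite of_to_suspension//; [exact: (realizationP x).2|exact: (realizationP x).1].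
  have /facesK[b xb] := (realizationP x).2.
  rewrite (cone_pathE xb)// mul0r /cone_contraction cover_contraction_le0//.
have cx : continuous (fun p : realization R K * unit_interval R => point_of p.1).
  by apply: cts_point_of; exact: cts_fst.
have cu : continuous (fun p : realization R K * unit_interval R => 1 - time p.2).
  by apply: cts_sub; [exact: cts_cst|apply: cts_time; exact: cts_snd].
have cc b i : continuous (fun p : realization R K * unit_interval R =>
    cone_contraction b (trunc (point_of p.1))
      ((1 - time p.2) * (3 * far (C (~~ b)) (point_of p.1) - 1)) i).
  apply: (@cts_coord _ T R (fun p => cone_contraction b _ _)).
  apply: cts_cover_contraction; first exact: cts_trunc.
  apply: cts_mul => //; apply: cts_sub; last exact: cts_cst.
  by apply: cts_mul; [exact: cts_cst|exact: cts_far].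
apply: cts_to_realization; apply: cts_ptws => i; apply: cts_sub.
  by apply: cts_add; [exact: (cc true i)|exact: (cc false i)].
exact: (@cts_coord _ T R (fun p => trunc (point_of p.1)) i (cts_trunc cx)).
Qed.

(** Drags [z] to the pole of [y], arriving when that pole coordinate of [y] is 1/3. Beyond this
    height [toS (ofS y)] and [y] may have unrelated base parts; once dragged, both sit at the
    pole. *)
Definition to_poles (y z : N) : N :=
  lerp (lerp z (vertex_point R (inr true)) (clamp (3 * y (inr true))))
    (vertex_point R (inr false)) (clamp (3 * y (inr false))).

Lemma to_polesE (y z : N) b : y (inr (~~ b)) = 0 ->
  to_poles y z = lerp z (vertex_point R (inr b)) (clamp (3 * y (inr b))).
Proof.
by rewrite /to_poles; case: b => /= ->; rewrite mulr0 [clamp 0]clamp_le0 ?lerp0.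
Qed.

Lemma cts_to_poles (X : topologicalType) (f g : X -> N) :
  continuous f -> continuous g -> continuous (fun p => to_poles (f p) (g p)).
Proof.
move=> cf cg.
have cc b : continuous (fun p => clamp (3 * f p (inr b))).
  apply: cts_clamp; apply: cts_mul; first exact: cts_cst.
  exact: (@cts_coord X (T + bool)%type R f (inr b) cf).
have cv b : continuous (fun _ : X => vertex_point R (inr b) : N).
  by apply: cts_ptws => i; exact: cts_cst.
by apply: cts_lerp => //; apply: cts_lerp.
Qed.

Lemma support_pole b (s : {set T + bool}) (y : N) :
  y (inr (~~ b)) = 0 -> base_part (support_set y) \subset base_part s ->
  support_set y \subset cone_face b (base_part s).
Proof.
move=> yb /fintype.subsetP ys; apply/fintype.subsetP => -[i yi|c].
  by have := ys i; rewrite !inE in yi *; exact.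
rewrite !inE; apply: contra_neqT => cb.
by have -> : c = ~~ b by case: c cb; case: (b).
Qed.

Lemma cone_face_pole b (t : {set T}) : [set inr b : T + bool]%SET \subset cone_face b t.
Proof. by rewrite finset.sub1set !inE. Qed.

Lemma to_poles_face b (y z : N) (t : {set T}) : y (inr (~~ b)) = 0 ->
  support_set z \subset cone_face b t ->
  support_set (to_poles y z) \subset cone_face b t.
Proof.
move=> yb zt; rewrite (to_polesE z yb).
apply: (fintype.subset_trans (support_lerp _ _ _)).
by rewrite finset.subUset zt support_vertex cone_face_pole.
Qed.

Lemma to_suspension_pole (x : M) b : support_set x \in C b ->
  to_suspension x (inr (~~ b)) = 0.
Proof. by move=> xb; rewrite /= negbK; exact: far_eq0 (@downC b) xb. Qed.

Lemma self_cone_face (y : N) b : y (inr (~~ b)) = 0 ->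
  support_set y \subset cone_face b (base_part (support_set y)).
Proof. by move=> yb; exact: support_pole. Qed.

Lemma barycentric_to_poles (y z : N) b : y (inr (~~ b)) = 0 -> barycentric z ->
  barycentric (to_poles y z).
Proof.
move=> yb bz; rewrite (to_polesE z yb); apply: barycentric_lerp => //.
  by rewrite clamp_ge0 clamp_le1.
exact: barycentric_vertex.
Qed.

Lemma to_polesP (y : realization R S) :
  barycentric (to_poles (point_of y) (point_of y)) /\
  support_set (to_poles (point_of y) (point_of y)) \in faces S.
Proof.
have [bY yS] := realizationP y; have [b yb] := suspension_pole yS.
split; first exact: barycentric_to_poles yb bY.
apply: (@cone_faceP _ _ b (base_part (support_set (point_of y)))).
  exact: base_partL.
exact: to_poles_face yb (self_cone_face yb).
Qed.

Lemma toS_pole (y : realization R S) b : point_of y (inr (~~ b)) = 0 ->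
  point_of (toS (ofS y)) (inr (~~ b)) = 0.
Proof.
move=> yb; have [bY yS] := realizationP y.
rewrite point_of_to_realization; apply: to_suspension_pole.
by rewrite point_of_to_realization; exact: (of_suspensionP bY yS yb).2.
Qed.

Lemma to_poles_toSP (y : realization R S) :
  barycentric (to_poles (point_of y) (point_of (toS (ofS y)))) /\
  support_set (to_poles (point_of y) (point_of (toS (ofS y)))) \in faces S.
Proof.
have [bz zS] := realizationP (toS (ofS y)).
have [b yb] := suspension_pole (realizationP y).2.
split; first exact: barycentric_to_poles yb bz.
apply: (@cone_faceP _ _ b (base_part (support_set (point_of (toS (ofS y)))))).
  exact: base_partL.
by apply: (to_poles_face yb); apply: self_cone_face; exact: (toS_pole yb).
Qed.

(** At this height the contraction has not started, so [ofS y] is the projection of [y] to the base;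
    [toS] then adds no base vertex, since truncation only shrinks supports. *)
Lemma toS_ofS_base (y : realization R S) b : point_of y (inr (~~ b)) = 0 ->
  point_of y (inr b) <= 1 / 3 ->
  support_set (point_of (toS (ofS y))) \subset
  cone_face b (base_part (support_set (point_of y))).
Proof.
move=> yb h; apply: support_pole; first exact: (toS_pole yb).
have [bY yS] := realizationP y.
have h2 : point_of y (inr b) <= 2 / 3 by lra.
have E : of_suspension (point_of y) = base_point (point_of y).
  by rewrite (of_suspensionE yb) /cone_contraction cover_contraction_le0//; lra.
have sE : support_set (of_suspension (point_of y)) = base_part (support_set (point_of y)).
  by rewrite E (support_base_point _).
rewrite -sE; apply: (fintype.subset_trans _ (support_trunc_sub _)).
apply/fintype.subsetP => i; rewrite !inE !point_of_to_realization/=.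
by rewrite mulf_eq0 negb_or => /andP[].
Qed.

(** Three straight-line homotopies, through [q] and [p]: dragging a point to its pole stays in the
    cone over its own base part, and the two dragged maps are contiguous. *)
Lemma toS_ofS_homotopic : homotopic R (toS \o ofS) idfun.
Proof.
pose p y := to_realization (to_polesP y).
pose q y := to_realization (to_poles_toSP y).
have cid : continuous (@idfun (realization R S)) by move=> y; exact: cvg_id.
have cfg : continuous (fun y => toS (ofS y)) by exact: cts_comp cts_ofS cts_toS.
have cp : continuous p.
  by apply: cts_to_realization; apply: cts_to_poles; apply: cts_point_of; exact: cid.
have cq : continuous q.
  apply: cts_to_realization; apply: cts_to_poles; apply: cts_point_of => //.
have yL (y : realization R S) : base_part (support_set (point_of y)) \in faces L.
  by apply: base_partL; exact: (realizationP y).2.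
apply: (@homotopic_trans _ _ _ _ _ q).
  apply: homotopic_lerp => // y; rewrite [point_of (q y)]point_of_to_realization.
  have [b yb] := suspension_pole (realizationP y).2.
  apply: (@cone_faceP _ _ b _ _ (yL (toS (ofS y)))).
  have zb := self_cone_face (toS_pole yb).
  by rewrite finset.subUset zb to_poles_face.
apply: (@homotopic_trans _ _ _ _ _ p); last first.
  apply: homotopic_lerp => // y; rewrite [point_of (p y)]point_of_to_realization.
  have [b yb] := suspension_pole (realizationP y).2.
  apply: (@cone_faceP _ _ b _ _ (yL y)).
  have zb := self_cone_face yb.
  by rewrite finset.subUset zb to_poles_face.
apply: homotopic_lerp => // y.
rewrite [point_of (p y)]point_of_to_realization [point_of (q y)]point_of_to_realization.
have [b yb] := suspension_pole (realizationP y).2.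
apply: (@cone_faceP _ _ b _ _ (yL y)); have zb := self_cone_face yb.
rewrite finset.subUset [X in _ && X]to_poles_face// andbT.
have [h|h] := leP (point_of y (inr b)) (1 / 3).
  by apply: to_poles_face => //; exact: toS_ofS_base.
rewrite (to_polesE _ yb) clamp_ge1 ?lerp1; last lra.
by rewrite support_vertex cone_face_pole.
Qed.

Lemma realization_two_cones :
  homotopy_equivalent R (realization R K) (realization R S).
Proof.
exists toS, ofS; split; [exact: cts_toS|exact: cts_ofS|..].
  exact: ofS_toS_homotopic.
exact: toS_ofS_homotopic.
Qed.

End TwoCones.

(** * The topological suspension *)

Lemma hausdorff_coord (R : realType) (X : topologicalType) (I : Type)
    (f : I -> X -> R) : (forall i, continuous (f i)) ->
  (forall x y, (forall i, f i x = f i y) -> x = y) -> hausdorff_space X.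
Proof.
move=> cf finj p q pq; apply: finj => i; apply: (@Rhausdorff R) => U V pU qV.
by have [z [? ?]] := pq _ _ (cf i p U pU) (cf i q V qV); exists (f i z).
Qed.

Lemma compact_set_type (X : topologicalType) (A : set X) :
  compact A -> compact [set: A]%classic.
Proof.
move=> cA F PF _; have FA : (val @ F)%classic A.
  by apply: (@filterE _ F) => x; exact: set_valP.
have [p [Ap clp]] := cA _ _ FA.
exists (exist _ p (mem_set Ap)); split=> // U V FU [W [[W' oW' WW'] Wp WV]].
have W'p : nbhs p W' by apply: open_nbhs_nbhs; split => //; move: Wp; rewrite -WW'.
have vU : (val @ F)%classic (val @` U)%classic.
  by apply: (@filterS _ F _ U) => // x Ux; exists x.
have [z [[x Ux xz] W'z]] := clp _ _ vU W'p.
by exists x; split => //; apply: WV; rewrite -WW' /= /set_val/= xz.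
Qed.

Lemma continuous_inverse (X Y : topologicalType) (f : X -> Y) (g : Y -> X) :
  compact [set: X]%classic -> hausdorff_space Y -> continuous f ->
  cancel f g -> cancel g f -> continuous g.
Proof.
move=> cX hY cf fK gK; apply/continuous_closedP => A cA.
have -> : (g @^-1` A = f @` A)%classic.
  apply/seteqP; split=> [y Ay|_ [x Ax <-]]; first by exists (g y).
  by rewrite /= fK.
apply: compact_closed => //; apply: continuous_compact.
  exact: continuous_subspaceT.
by apply: (subclosed_compact cA cX).
Qed.

(** * Compactness and separation of realizations and suspensions *)

Section CompactRealization.
Variables (R : realType) (T : finType).
Local Notation M := {ptws T -> R}.

(* Its zero set is the realization, which is therefore closed. *)
Definition defect (K : scomplex T) (x : M) : R :=
  \sum_i Num.max 0 (- x i) + (\sum_i x i - 1) ^+ 2 +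
  \sum_(s | s \notin faces K) (\prod_(i in s) x i) ^+ 2.

Lemma defect_eq0 K x : defect K x = 0 <-> realization_set K x.
Proof.
have s1 : 0 <= \sum_i Num.max 0 (- x i).
  by apply: sumr_ge0 => i _; rewrite le_max lexx.
have s2 : 0 <= (\sum_i x i - 1) ^+ 2 by rewrite sqr_ge0.
have s3 : 0 <= \sum_(s | s \notin faces K) (\prod_(i in s) x i) ^+ 2.
  by apply: sumr_ge0 => s _; rewrite sqr_ge0.
split=> [/eqP|/realization_setE[[x0 x1] xK]].
  rewrite /defect paddr_eq0 ?addr_ge0// paddr_eq0//.
  move=> /andP[/andP[/eqP h1 /eqP h2] /eqP h3]; split.
  - move=> i; have h : forall i : T, true -> 0 <= Num.max 0 (- x i).
      by move=> j _; rewrite le_max lexx.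
    rewrite leNgt; apply/negP => xi.
    have : 0 < Num.max 0 (- x i) by rewrite lt_max oppr_gt0 xi orbT.
    by rewrite (psumr_eq0P h h1)// ltxx.
  - by move/eqP: h2; rewrite sqrf_eq0 subr_eq0 => /eqP.
  - apply: contraT => xK.
    have h : forall s : {set T}, s \notin faces K -> 0 <= (\prod_(i in s) x i) ^+ 2.
      by move=> s _; rewrite sqr_ge0.
    have /eqP := psumr_eq0P h h3 xK.
    rewrite sqrf_eq0 prodf_seq_eq0 => /hasP[i _ /andP[]].
    by rewrite inE => /negPf ->.
rewrite /defect x1 subrr expr0n/= addr0 big1 ?add0r => [|i _]; last first.
  by rewrite max_l// oppr_le0.
rewrite big1// => s sK.
have /subsetPn[i si] : ~~ (s \subset support_set x).
  by apply: contra sK => /(faces_closed xK).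
by rewrite inE negbK => /eqP xi; rewrite (bigD1 i)//= xi mul0r expr0n.
Qed.

Lemma cts_defect K : continuous (defect K).
Proof.
have cid : continuous (@idfun M) by move=> x; exact: cvg_id.
have cx i : continuous (fun x : M => x i) by exact: (@cts_coord M T R idfun i cid).
apply: cts_add; first apply: cts_add.
- apply: cts_sum => i; apply: cts_max; first exact: cts_cst.
  have -> : (fun x : M => - x i) = (fun x => 0 - x i).
    by apply/funext => x; rewrite sub0r.
  by apply: cts_sub => //; exact: cts_cst.
- by apply: cts_mul; apply: cts_sub; (try exact: cts_cst); exact: cts_sum.
- by apply: cts_sum => s; apply: cts_mul; apply: cts_prod => i.
Qed.

Lemma compact_realization (K : scomplex T) :
  compact [set: realization R K]%classic.
Proof.
apply: compact_set_type.
apply: (@subclosed_compact _ _ [set x : M | forall i : T, `[0, 1]%classic (x i)]%classic).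
- have -> : @realization_set R T K = (defect K @^-1` [set x | x = 0])%classic.
    by apply/seteqP; split=> x; rewrite /= defect_eq0.
  apply: closed_comp; last exact: closed_eq.
  by move=> x _; exact: cts_defect.
- exact: (@tychonoff T (fun _ => R) (fun _ => `[0, 1]%classic)
    (fun _ => @segment_compact R 0 1)).
- move=> x [x0 x1 _] i; rewrite /= in_itv/= x0/= -x1 (bigD1 i)//= lerDl.
  exact: sumr_ge0.
Qed.

Lemma hausdorff_realization (K : scomplex T) :
  hausdorff_space (realization R K).
Proof.
apply: (@hausdorff_coord R _ T (fun i x => point_of x i)).
  by move=> i; apply: cts_point_coord => x; exact: cvg_id.
by move=> x y xy; apply: point_of_inj; apply/funext.
Qed.

Lemma compact_suspension (X : topologicalType) :
  compact [set: X]%classic -> compact [set: suspension R X]%classic.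
Proof.
move=> cX; have -> : [set: suspension R X]%classic =
    (\pi_(suspension R X) @` [set: susp_sum R X])%classic.
  apply/seteqP; split=> // x _; exists (repr x) => //; exact: reprK.
apply: continuous_compact.
  by apply: continuous_subspaceT; exact: pi_continuous.
apply: sigT_compact; first exact: finite_finset.
case; first exact: bool_compact.
rewrite -setXTT; apply: compact_setX => //.
by apply: compact_set_type; exact: segment_compact.
Qed.

End CompactRealization.

(** * The simplicial suspension realizes the topological one *)

Section SuspensionHomeomorphism.
Variables (R : realType) (T : finType) (L : scomplex T).
Local Notation X := (realization R L).
Local Notation S := (suspension_complex L).
Local Notation N := {ptws (T + bool)%type -> R}.

(** The base sits at height [t = 1/2]; above it the point moves linearly to the pole [true], below
    it to the pole [false], and at most one of the two maxima is nonzero. *)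
Definition join_point (x : {ptws T -> R}) (t : R) : N := fun k =>
  match k with
  | inl i => (1 - Num.max 0 (2 * t - 1) - Num.max 0 (1 - 2 * t)) * x i
  | inr true => Num.max 0 (2 * t - 1)
  | inr false => Num.max 0 (1 - 2 * t)
  end.

Lemma join_pointP (x : X) (t : unit_interval R) :
  barycentric (join_point (point_of x) (time t)) /\
  support_set (join_point (point_of x) (time t)) \in faces S.
Proof.
have [[x0 x1] xL] := realizationP x; have t01 := timeP t.
split; first split.
- case=> [i|[]]; rewrite /= ?le_max ?lexx//; apply: mulr_ge0 => //.
  by case: (ltP 0 (2 * time t - 1)); case: (ltP 0 (1 - 2 * time t)); lra.
- by rewrite big_sumType/= big_bool/= -mulr_sumr x1 mulr1; lra.
- rewrite inE; apply/andP; split.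
    apply: (faces_closed xL); apply/fintype.subsetP => i; rewrite !inE/=.
    by rewrite mulf_eq0 negb_or => /andP[].
  rewrite !inE/=; case: (leP (2 * time t) 1) => h.
    by rewrite max_l ?eqxx//; lra.
  by rewrite [X in _ && (X != 0)]max_l ?eqxx ?andbF//; lra.
Qed.

Hypothesis set0L : finset.set0 \in faces L.

(** This needs only the empty face of [L]: when [L] has no other face, its realization is empty and
    both suspensions consist of the two poles. *)
Lemma poleP (b : bool) :
  barycentric (vertex_point R (inr b : T + bool)%type) /\
  support_set (vertex_point R (inr b : T + bool)%type) \in faces S.
Proof.
split; first exact: barycentric_vertex.
rewrite support_vertex inE; apply/andP; split; last by case: b; rewrite !inE.
by rewrite (_ : base_part _ = finset.set0)//; apply/finset.setP => i; rewrite !inE.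
Qed.

Definition join_part (b : bool) : susp_part R X b -> realization R S :=
  match b return susp_part R X b -> realization R S with
  | true => fun c => to_realization (poleP c)
  | false => fun xt => to_realization (join_pointP xt.1 xt.2)
  end.

Definition join_map (p : susp_sum R X) : realization R S := join_part (projT2 p).

Lemma cts_join_map : continuous join_map.
Proof.
apply: (@sigT_continuous _ _ _ join_part) => -[].
  apply: cts_to_realization; apply: cts_ptws => i.
  by apply/continuousP => A _; exact: discrete_open.
have c1 : continuous (fun p : X * unit_interval R => 2 * time p.2).
  apply: cts_mul; first exact: cts_cst.
  by apply: cts_time; exact: cts_snd.
have cM1 : continuous (fun p : X * unit_interval R => Num.max 0 (2 * time p.2 - 1)).
  by apply: cts_max; [exact: cts_cst|apply: cts_sub => //; exact: cts_cst].
have cM2 : continuous (fun p : X * unit_interval R => Num.max 0 (1 - 2 * time p.2)).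
  by apply: cts_max; [exact: cts_cst|apply: cts_sub => //; exact: cts_cst].
apply: cts_to_realization; apply: cts_ptws => -[i|[]] //.
apply: cts_mul; last by apply: cts_point_coord; exact: cts_fst.
by apply: cts_sub => //; apply: cts_sub => //; exact: cts_cst.
Qed.

Lemma join_map_pole p b :
  susp_pole p = Some b -> point_of (join_map p) = vertex_point R (inr b).
Proof.
case: p => -[c [->]//|[x t]]; rewrite /susp_pole /= -/(time t).
case: eqP => [t0 [<-]|_]; last case: eqP => // t1 [<-];
  apply/funext => -[i|c]; rewrite point_of_to_realization /vertex_point /=.
- by rewrite t0 mulr0n; case: (ltP 0 (2 * 0 - 1)); case: (ltP 0 (1 - 2 * 0)); lra.
- by rewrite t0; case: c; rewrite /= ?mulr0n ?mulr1n;
    [case: (ltP 0 (2 * 0 - 1))|case: (ltP 0 (1 - 2 * 0))]; lra.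
- by rewrite t1 mulr0n; case: (ltP 0 (2 * 1 - 1)); case: (ltP 0 (1 - 2 * 1)); lra.
- by rewrite t1; case: c; rewrite /= ?mulr0n ?mulr1n;
    [case: (ltP 0 (2 * 1 - 1))|case: (ltP 0 (1 - 2 * 1))]; lra.
Qed.

Lemma join_map_pole_coord p b :
  point_of (join_map p) (inr b) = 1 -> susp_pole p = Some b.
Proof.
case: p => -[c|[x t]]; rewrite point_of_to_realization.
  by rewrite /vertex_point /=; case: eqP => [[->]//|_ /eqP]; rewrite eq_sym oner_eq0.
rewrite /susp_pole /= -/(time t); have := timeP t.
case: b => /= /andP[t0 t1].
  case: (ltP 0 (2 * time t - 1)) => [_ h|_ /eqP]; last by rewrite eq_sym oner_eq0.
  have -> : time t = 1 by lra.
  by rewrite oner_eq0 eqxx.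
case: (ltP 0 (1 - 2 * time t)) => [_ h|_ /eqP]; last by rewrite eq_sym oner_eq0.
have -> : time t = 0 by lra.
by rewrite eqxx.
Qed.

(** One direction makes the induced map on the quotient well defined, the other makes it
    injective. *)
Lemma join_map_glue p q : susp_glue p q = (join_map p == join_map q).
Proof.
apply/idP/eqP => [/predU1P[->//|/andP[]]|pq].
  case E : (susp_pole p) => [b|]// _ /eqP/esym Eq; apply: point_of_inj.
  by rewrite (join_map_pole E) (join_map_pole Eq).
case Ep : (susp_pole p) => [b|].
  have Eq : susp_pole q = Some b.
    apply: join_map_pole_coord; rewrite -pq (join_map_pole Ep).
    by rewrite /vertex_point eqxx.
  by rewrite /susp_glue Ep Eq eqxx orbT.
case Eq : (susp_pole q) => [b|].
  have : susp_pole p = Some b.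
    apply: join_map_pole_coord; rewrite pq (join_map_pole Eq).
    by rewrite /vertex_point eqxx.
  by rewrite Ep.
rewrite /susp_glue; apply/orP; left; apply/eqP.
case: p q pq Ep Eq => -[//|[x t]] [[//|[y u]]] pq.
rewrite /susp_pole /= -!/(time _) => Et Eu.
have {pq}pq k : join_point (point_of x) (time t) k = join_point (point_of y) (time u) k.
  by have := congr1 (fun z => point_of z k) pq.
(* The two pole coordinates determine the height; strictly between the poles the factor of the base
   coordinates is nonzero and can be cancelled. *)
have tu : time t = time u.
  have := pq (inr true); have := pq (inr false); rewrite /=.
  by case: (ltP 0 (2 * time t - 1)); case: (ltP 0 (1 - 2 * time t));
    case: (ltP 0 (2 * time u - 1)); case: (ltP 0 (1 - 2 * time u)); lra.
have {Eu} tu' : t = u by exact: val_inj.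
rewrite -tu'; suff -> : x = y by [].
apply: point_of_inj; apply/funext => i.
have := pq (inl i); rewrite /= -tu => /mulfI; apply.
move: Et (timeP t); case: eqP => // t0; case: eqP => // t1 _ /andP[t0' t1'].
have : 0 < time t by rewrite lt_neqAle t0' andbT eq_sym; apply/eqP.
have : time t < 1 by rewrite lt_neqAle t1' andbT; apply/eqP.
by case: (ltP 0 (2 * time t - 1)); case: (ltP 0 (1 - 2 * time t)) => *;
  apply: lt0r_neq0; lra.
Qed.

Lemma join_map_surj (y : realization R S) : exists p, join_map p = y.
Proof.
have [bY yS] := realizationP y; have [b yb] := suspension_pole yS.
have [y0 y1] := bY; have bs := base_sum bY yb.
have s0 := y0 (inr b).
have s1 : point_of y (inr b) <= 1.
  by rewrite -subr_ge0 -bs; apply: sumr_ge0 => i _; exact: y0.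
have [E|E] := eqVneq (point_of y (inr b)) 1.
  exists (existT _ true b); apply: point_of_inj; rewrite point_of_to_realization.
  apply/funext => -[i|c]; rewrite /vertex_point /=.
    have /psumr_eq0P H0 : \sum_i point_of y (inl i) = 0 by rewrite bs E subrr.
    by rewrite H0.
  case: eqP => [[->]//|cb].
  have -> : c = ~~ b by case: c cb; case: (b) => // -[].
  by rewrite yb.
have s2 : 0 < 1 - point_of y (inr b) by rewrite subr_gt0 lt_neqAle E.
pose x : {ptws T -> R} := fun i => point_of y (inl i) / (1 - point_of y (inr b)).
have xP : barycentric x /\ support_set x \in faces L.
  split; first split.
  - by move=> i; rewrite divr_ge0// ltW.
  - by rewrite -mulr_suml bs divff// gt_eqF.
  - apply: (faces_closed (base_partL yS)); apply/fintype.subsetP => i.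
    by rewrite !inE mulf_eq0 negb_or => /andP[].
(* The height solves [2 * s - 1 = y (inr b)] for the pole [true] and [1 - 2 * s = y (inr b)] for the
   pole [false]. *)
pose s : R := if b then (1 + point_of y (inr b)) / 2 else (1 - point_of y (inr b)) / 2.
have sE : clamp s = s.
  by apply: clamp_id; rewrite /s; case: (b) s0 s1 => /=; lra.
exists (existT _ false (to_realization xP, clamp_interval s)).
apply: point_of_inj; rewrite point_of_to_realization; apply/funext => k.
rewrite time_clamp_interval sE point_of_to_realization.
have -> : point_of y k = match k with
    | inl i => (1 - point_of y (inr b)) * x i
    | inr c => if c == b then point_of y (inr b) else 0 end.
  case: k => [i|c]; first by rewrite /x mulrC divfK// gt_eqF.
  case: eqP => [->//|cb]; rewrite -yb; congr (point_of y (inr _)).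
  by case: c cb; case: (b).
rewrite /join_point /s; case: (b) s0 s1 => s0 s1.
  have -> : 2 * ((1 + point_of y (inr true)) / 2) = 1 + point_of y (inr true) by field.
  case: k => [i|[]]/=.
  - by rewrite max_r ?[Num.max 0 (1 - _)]max_l; (try lra); congr (_ * _); lra.
  - by rewrite max_r; lra.
  - by rewrite max_l; lra.
have -> : 2 * ((1 - point_of y (inr false)) / 2) = 1 - point_of y (inr false) by field.
case: k => [i|[]]/=.
- by rewrite max_l ?[Num.max 0 (1 - _)]max_r; (try lra); congr (_ * _); lra.
- by rewrite max_l; lra.
- by rewrite max_r; lra.
Qed.

Lemma susp_glueP (p q : susp_sum R X) :
  reflect (\pi_(suspension R X) p = \pi_(suspension R X) q) (susp_glue p q).
Proof. exact: (@eqmodP _ (susp_rel R X) p q). Qed.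

(** The inverse is chosen pointwise; a continuous bijection from a compact space to a Hausdorff
    space has a continuous inverse. *)
Lemma suspension_homeomorphic : exists (f : suspension R X -> realization R S)
    (g : realization R S -> suspension R X),
  [/\ continuous f, continuous g, cancel f g & cancel g f].
Proof.
pose f (z : suspension R X) := join_map (repr z).
have fpi p : f (\pi_(suspension R X) p) = join_map p.
  by apply/eqP; rewrite -join_map_glue; apply/susp_glueP; exact: reprK.
have cf : continuous f.
  apply: repr_comp_continuous; first exact: cts_join_map.
  by move=> p q /eqP pq; rewrite -join_map_glue; apply/susp_glueP; exact: pq.
have /choice[g gP] y : exists z, f z = y.
  by have [p <-] := join_map_surj y; exists (\pi_(suspension R X) p).
have finj : injective f.
  move=> u w /eqP; rewrite -join_map_glue => uw.
  by rewrite -[u]reprK -[w]reprK; apply/susp_glueP.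
have fK : cancel f g by move=> z; apply: finj; rewrite gP.
exists f, g; split => //; apply: (continuous_inverse _ _ cf fK gP).
  by apply: compact_suspension; exact: compact_realization.
exact: hausdorff_realization.
Qed.

End SuspensionHomeomorphism.

Lemma homotopy_equivalent_homeomorphic (R : realType) (X Y Z : topologicalType)
    (p : Z -> Y) (q : Y -> Z) : continuous p -> continuous q ->
  cancel p q -> cancel q p ->
  homotopy_equivalent R X Y -> homotopy_equivalent R X Z.
Proof.
move=> cp cq pK qK [f [g [cf cg gf [F [cF FE]]]]].
exists (fun x => q (f x)), (fun z => g (p z)); split.
- exact: cts_comp cf cq.
- exact: cts_comp cp cg.
- by move: gf; congr (homotopic R _ _); apply/funext => x /=; rewrite qK.
exists (fun zt => q (F (p zt.1, zt.2))); split.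
  apply: (cts_comp _ cq); apply: (cts_comp _ cF); apply: cts_pair; last exact: cts_snd.
  by apply: (cts_comp _ cp); exact: cts_fst.
move=> z t; have [F0 F1] := FE (p z) t.
by split=> [/F0|/F1] /= ->; rewrite ?pK.
Qed.

(** * First homology *)

(** This is the freeness of subgroups of [int ^ n], for the image of [P] under the [psi i], with the
    basis lifted to [Z]. The subgroup is a predicate so that the induction can pass to the kernel of
    [psi n] in [P]; a value of [psi n] on [P] of least nonzero size supplies the extra basis
    element. *)
Lemma lattice_basis (Z : zmodType) (psi : nat -> {additive Z -> int}) (n : nat)
    (P : Z -> Prop) : P 0 -> (forall x y, P x -> P y -> P (x - y)) ->
  exists k (b : 'I_k -> Z), [/\ forall j, P (b j),
    forall z, P z -> exists c : 'I_k -> int, forall i, (i < n)%N ->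
      psi i (z - \sum_j b j *~ c j) = 0
    & forall c : 'I_k -> int, (forall i, (i < n)%N ->
      psi i (\sum_j b j *~ c j) = 0) -> forall j, c j = 0].
Proof.
elim: n P => [|n IH] P P0 PB.
  exists 0%N, (fun _ => 0); split=> [[]//|z _|c _ []//].
  by exists (fun _ => 0).
have PN x : P x -> P (- x) by move=> Px; rewrite -sub0r; exact: PB.
have PD x y : P x -> P y -> P (x + y).
  by move=> Px Py; rewrite -[y]opprK; apply: PB => //; exact: PN.
have PMn x m : P x -> P (x *+ m).
  by move=> Px; elim: m => [|m Pm]; rewrite ?mulr0n// mulrS; exact: PD.
have PM x (m : int) : P x -> P (x *~ m).
  by case: m => m Px; rewrite ?NegzE ?mulrNz -pmulrn; try apply: PN; exact: PMn.
have [|x y [Px x0] [Py y0]|k [b [Pb bspan bfree]]] :=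
  IH (fun z => P z /\ psi n z = 0).
- by rewrite raddf0.
- by split; [exact: PB|rewrite raddfB x0 y0 subrr].
have psib c : psi n (\sum_j b j *~ c j) = 0.
  rewrite raddf_sum big1// => j _; rewrite raddfMz.
  by rewrite (Pb j).2 mul0rz.
have [all0|nall0] := pselect (forall z, P z -> psi n z = 0).
  exists k, b; split=> [j|z Pz|c c0].
  - exact: (Pb j).1.
  - have [c cz] := bspan z (conj Pz (all0 z Pz)).
    exists c => i; rewrite ltnS leq_eqVlt => /predU1P[->|/cz//].
    by rewrite raddfB psib all0// subrr.
  - by apply: bfree => i i_n; apply: c0; exact: ltnW.
have exP : exists d, `[< exists2 z, P z & psi n z != 0 /\ `|psi n z|%N = d >].
  move/existsNP: nall0 => [z /not_implyP[Pz /eqP z0]].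
  by exists `|psi n z|%N; apply/asboolP; exists z.
have [d /asboolP[p Pp [p0 pd]] dmin] := ex_minnP exP.
(* Euclidean division: a nonzero remainder would be a value of [psi n] on [P] smaller than the
   minimum [d]. *)
have divp z : P z -> exists q : int, psi n (z - p *~ q) = 0.
  move=> Pz; pose q := (psi n z %/ psi n p)%Z; exists q.
  have rE : psi n (z - p *~ q) = (psi n z %% psi n p)%Z.
    by rewrite raddfB raddfMz /modz mulrzz mulrC.
  have [//|r0] := eqVneq (psi n (z - p *~ q)) 0.
  pose w := psi n (z - p *~ q).
  have /dmin : `[< exists2 y, P y & psi n y != 0 /\ `|psi n y|%N = `|w|%N >].
    apply/asboolP; exists (z - p *~ q) => //.
    by apply: PB => //; exact: PM.
  rewrite leqNgt -pd => /negP[].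
  by rewrite -ltz_nat !abszE /w rE (ger0_norm (modz_ge0 _ _))// ltz_mod.
exists k.+1, (fun j => if unlift ord0 j is Some j' then b j' else p); split.
- by move=> j; case: unliftP => [j' _|_]; [exact: (Pb j').1|].
- move=> z Pz; have [q q0] := divp z Pz.
  have [c cz] := bspan _ (conj (PB _ _ Pz (PM _ q Pp)) q0).
  exists (fun j => if unlift ord0 j is Some j' then c j' else q) => i i_n.
  rewrite big_ord_recl unlift_none opprD addrA.
  under eq_bigr do rewrite liftK.
  move: i_n; rewrite ltnS leq_eqVlt => /predU1P[->|/cz//].
  by rewrite raddfB psib q0 subrr.
- move=> c c0.
  have E : \sum_j (if unlift ord0 j is Some j' then b j' else p) *~ c j =
           p *~ c ord0 + \sum_j b j *~ c (lift ord0 j).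
    by rewrite big_ord_recl unlift_none; under eq_bigr do rewrite liftK.
  have c00 : c ord0 = 0.
    have := c0 n (ltnSn n); rewrite E raddfD psib addr0 raddfMz => /eqP.
    by rewrite mulrz_eq0 (negPf p0) orbF => /eqP.
  have cl : forall j, c (lift ord0 j) = 0.
    apply: bfree => i i_n; have := c0 i (ltnW i_n).
    by rewrite E c00 mulr0z add0r.
  by move=> j; case: (unliftP ord0 j) => [j' ->|->].
Qed.

(** Since the kernel of [p] is the common kernel of the functionals, [A] embeds in [int ^ n]. *)
Lemma free_abelian_functionals (Z A : zmodType) (p : {additive Z -> A})
    (psi : nat -> {additive Z -> int}) (n : nat) :
  (forall a, exists z, p z = a) ->
  (forall z, p z = 0 <-> forall i, (i < n)%N -> psi i z = 0) ->
  free_abelian A.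
Proof.
move=> psurj pker.
have [//|//|k [b [_ bspan bfree]]] := @lattice_basis Z psi n (fun _ => True).
have sumE (s : {fset 'I_k}) (F : 'I_k -> A) :
    \sum_(i <- s) F i = \sum_(i in s) F i.
  by rewrite big_uniq//= fset_uniq.
have psum (c : 'I_k -> int) : p (\sum_j b j *~ c j) = \sum_j p (b j) *~ c j.
  by rewrite raddf_sum; apply: eq_bigr => j _; rewrite raddfMz.
exists 'I_k, (fun j => p (b j)); split.
  move=> a; have [z <-] := psurj a; have [c cz] := bspan z I.
  exists [fset j | j in 'I_k]%fset, c.
  rewrite sumE (eq_bigl predT) => [|j]; last by rewrite in_fset.
  rewrite -psum; apply/eqP; rewrite -subr_eq0 -raddfB; apply/eqP.
  exact/pker.
move=> s c; rewrite sumE => s0 i si.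
(* Extension by 0 turns a relation over [s] into one over all basis indices. *)
pose c' j := if j \in s then c j else 0.
suff : c' i = 0 by rewrite /c' si.
apply: bfree; apply/pker; rewrite psum -[RHS]s0 [RHS]big_mkcond.
by apply: eq_bigr => j _; rewrite /c'; case: ifP => // _; rewrite mulr0z.
Qed.

(** * Edges, triangles and 1-chains modulo boundaries *)

Section FirstHomology.
Variables (T : finType) (K : scomplex T).
Implicit Types (x y z : T) (s t : {set T}).
Local Notation rk x := (nat_of_ord (enum_rank x)).

(** The zero chain unless [s] is a face of cardinality [n], so that chains can be written without
    membership proofs. *)
Definition cell n s : chain K n := [ffun f => (val f == s)%:R].

Lemma boundary_cell n s : s \in faces K -> #|s| = n.+1 ->
  boundary (cell n.+1 s) = [ffun t => incidence s (val t)].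
Proof.
move=> sK sn; apply/ffunP => t; rewrite !ffunE.
have sP : (s \in faces K) && (#|s| == n.+1) by rewrite sK sn eqxx.
rewrite (bigD1 (exist _ s sP))//= ffunE /= eqxx mulr1 big1 ?addr0// => f fs.
rewrite ffunE; case: eqP => [e|_]; last by rewrite mulr0.
by case/eqP: fs; apply: val_inj.
Qed.

Lemma rk_neq x y : (rk x < rk y)%N -> (x == y) = false.
Proof. by apply: contraTF => /eqP ->; rewrite ltnn. Qed.

Lemma incidence2 x y t : (rk x < rk y)%N ->
  incidence [set x; y]%SET t = ([set y]%SET == t)%:R - ([set x]%SET == t)%:R.
Proof.
move=> xy; have nxy := rk_neq xy; rewrite /incidence big_mkcondr /=.
rewrite big_setU1 ?finset.in_set1 ?nxy//= big_set1.
have -> : ([set x; y] :\ x)%SET = [set y]%SET.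
  apply/finset.setP => z; rewrite !inE; have [->|//] := eqVneq z x.
  by rewrite nxy.
have -> : ([set x; y] :\ y)%SET = [set x]%SET.
  apply/finset.setP => z; rewrite !inE; have [->|_] := eqVneq z y.
    by rewrite eq_sym nxy.
  by rewrite orbF.
have -> : position [set x; y]%SET x = 0%N.
  apply/eqP; rewrite cards_eq0; apply/eqP/finset.setP => z; rewrite !inE.
  by apply/negP => /andP[/orP[]/eqP->]; rewrite ?ltnn// ltnNge ltnW.
have -> : position [set x; y]%SET y = 1%N.
  rewrite /position (_ : [set _ in _ | _]%SET = [set x]%SET) ?cards1//.
  apply/finset.setP => z; rewrite !inE.
  have [->|_] := eqVneq z x; first by rewrite xy.
  by case: eqP => //= ->; rewrite ltnn.
by rewrite addrC; do 2 case: eqP => _.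
Qed.

Lemma incidence3 x y z t : (rk x < rk y)%N -> (rk y < rk z)%N ->
  incidence [set x; y; z]%SET t =
  ([set y; z]%SET == t)%:R - ([set x; z]%SET == t)%:R + ([set x; y]%SET == t)%:R.
Proof.
move=> xy yz; have xz := ltn_trans xy yz.
have nxy := rk_neq xy; have nyz := rk_neq yz; have nxz := rk_neq xz.
rewrite /incidence big_mkcondr /=.
rewrite -finset.setUA big_setU1 ?finset.in_set2 ?nxy ?nxz//=.
rewrite big_setU1 ?finset.in_set1 ?nyz//= big_set1.
have -> : ((x |: [set y; z]) :\ x)%SET = [set y; z]%SET.
  apply/finset.setP => w; rewrite !inE; have [->|//] := eqVneq w x.
  by rewrite nxy nxz.
have -> : ((x |: [set y; z]) :\ y)%SET = [set x; z]%SET.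
  apply/finset.setP => w; rewrite !inE; have [->|//] := eqVneq w y.
  by rewrite eq_sym nxy nyz.
have -> : ((x |: [set y; z]) :\ z)%SET = [set x; y]%SET.
  apply/finset.setP => w; rewrite !inE; have [->|_] := eqVneq w z.
    by rewrite eq_sym nxz eq_sym nyz.
  by rewrite orbF.
have -> : position (x |: [set y; z])%SET x = 0%N.
  apply/eqP; rewrite cards_eq0; apply/eqP/finset.setP => w; rewrite !inE.
  by apply/negP => /andP[/or3P[]/eqP->]; rewrite ?ltnn// ltnNge ltnW.
have -> : position (x |: [set y; z])%SET y = 1%N.
  rewrite /position (_ : [set _ in _ | _]%SET = [set x]%SET) ?cards1//.
  apply/finset.setP => w; rewrite !inE.
  have [->|_] := eqVneq w x; first by rewrite xy.
  have [->|_] := eqVneq w y; first by rewrite ltnn.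
  by case: eqP => //= ->; rewrite ltnNge ltnW.
have -> : position (x |: [set y; z])%SET z = 2%N.
  rewrite /position (_ : [set _ in _ | _]%SET = [set x; y]%SET) ?cards2 ?nxy//.
  apply/finset.setP => w; rewrite !inE.
  have [->|_] := eqVneq w x; first by rewrite xz.
  have [->|_] := eqVneq w y; first by rewrite yz.
  by case: eqP => //= ->; rewrite ltnn.
by do 3 case: eqP => _.
Qed.

Definition bounds (c : chain K 2) : Prop := exists d : chain K 3, boundary d = c.

Lemma bounds0 : bounds 0. Proof. by exists 0; rewrite raddf0. Qed.

Lemma boundsB c d : bounds c -> bounds d -> bounds (c - d).
Proof. by move=> [c' <-] [d' <-]; exists (c' - d'); rewrite raddfB. Qed.

Lemma boundsN c : bounds c -> bounds (- c).
Proof. by rewrite -sub0r; apply: boundsB; exact: bounds0. Qed.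

Lemma boundsD c d : bounds c -> bounds d -> bounds (c + d).
Proof. by move=> bc bd; rewrite -[d]opprK; apply: boundsB => //; exact: boundsN. Qed.

Lemma boundsMz c m : bounds c -> bounds (c *~ m).
Proof. by move=> [c' <-]; exists (c' *~ m); rewrite raddfMz. Qed.

Lemma bounds_sum (I : finType) (P : pred I) (F : I -> chain K 2) :
  (forall i, P i -> bounds (F i)) -> bounds (\sum_(i | P i) F i).
Proof. by move=> bF; apply: (big_ind bounds) => //; [exact: bounds0|exact: boundsD]. Qed.

Lemma bounds_sym c d : bounds (c - d) -> bounds (d - c).
Proof. by move=> /boundsN; rewrite opprB. Qed.

Lemma bounds_trans c d e : bounds (c - d) -> bounds (d - e) -> bounds (c - e).
Proof. by move=> cd de; have := boundsD cd de; rewrite addrA subrK. Qed.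

Lemma bounds_addl e c d : bounds (c - d) -> bounds (e + c - (e + d)).
Proof. by rewrite opprD addrACA subrr add0r. Qed.

Lemma bounds_addr e c d : bounds (c - d) -> bounds (c + e - (d + e)).
Proof. by rewrite opprD addrACA subrr addr0. Qed.

Definition edge x y : chain K 2 :=
  if (rk x < rk y)%N then cell 2 [set x; y]
  else if (rk y < rk x)%N then - cell 2 [set x; y] else 0.

Lemma edgexx x : edge x x = 0.
Proof. by rewrite /edge ltnn. Qed.

Lemma edgeC x y : edge x y = - edge y x.
Proof.
rewrite /edge [[set y; x]%SET]finset.setUC; case: ltngtP => _ //.
  by rewrite opprK.
by rewrite oppr0.
Qed.

Lemma edge_lt x y : (rk x < rk y)%N -> edge x y = cell 2 [set x; y].
Proof. by rewrite /edge => ->. Qed.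

Lemma rk_inj x y : rk x = rk y -> x = y.
Proof. by move=> /val_inj/enum_rank_inj. Qed.

Lemma boundary_triangle x y z : (rk x < rk y)%N -> (rk y < rk z)%N ->
  [set x; y; z]%SET \in faces K ->
  boundary (cell 3 [set x; y; z]) = edge y z - edge x z + edge x y.
Proof.
move=> xy yz f; have xz := ltn_trans xy yz; rewrite boundary_cell//; last first.
  rewrite finset.setUC cardsU1 finset.in_set2 cards2 (rk_neq xy).
  by rewrite ![z == _]eq_sym (rk_neq yz) (rk_neq xz).
apply/ffunP => t; rewrite ffunE incidence3// !edge_lt// !ffunE.
by rewrite ![_ == val t]eq_sym.
Qed.

Definition loop x y z := edge x y + edge y z + edge z x.

Lemma loop_rot x y z : loop y z x = loop x y z.
Proof. by rewrite /loop addrC addrA. Qed.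

Lemma loop_swap x y z : loop y x z = - loop x y z.
Proof.
by rewrite /loop (edgeC y x) (edgeC x z) (edgeC z y) !opprD addrAC.
Qed.

Lemma loopxx x z : loop x x z = 0.
Proof. by rewrite /loop edgexx add0r edgeC addNr. Qed.

(** A loop is invariant under rotation and changes sign under a swap, so the vertices may be sorted;
    a repeated vertex gives the zero chain. *)
Lemma loop_bounds x y z : [set x; y; z]%SET \in faces K -> bounds (loop x y z).
Proof.
have sorted a b c : (rk a < rk b)%N -> (rk b < rk c)%N ->
    [set a; b; c]%SET \in faces K -> bounds (loop a b c).
  move=> ab bc f; exists (cell 3 [set a; b; c]); rewrite boundary_triangle//.
  by rewrite /loop (edgeC c a) addrC addrA.
have setr a b c : [set b; c; a]%SET = [set a; b; c]%SET.
  by apply/finset.setP => w; rewrite !inE; case: (w == a); case: (w == b); case: (w == c).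
have sets a b c : [set b; a; c]%SET = [set a; b; c]%SET.
  by apply/finset.setP => w; rewrite !inE; case: (w == a); case: (w == b); case: (w == c).
wlog xy : x y / (rk x < rk y)%N.
  move=> H; case: (ltngtP (rk x) (rk y)) => [|yx|/rk_inj->]; first exact: H.
    by move=> f; rewrite loop_swap; apply: boundsN; apply: H => //; rewrite sets.
  by move=> _; rewrite loopxx; exact: bounds0.
move=> f; case: (ltngtP (rk y) (rk z)) => [yz|zy|/rk_inj->].
- exact: sorted.
- case: (ltngtP (rk x) (rk z)) => [xz|zx|/rk_inj->].
  + rewrite -loop_rot loop_swap; apply: boundsN; rewrite -2!loop_rot.
    by apply: sorted => //; rewrite -setr sets setr.
  + by rewrite -2!loop_rot; apply: sorted => //; rewrite -setr.
  + by rewrite -2!loop_rot loopxx; exact: bounds0.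
- by rewrite -loop_rot loopxx; exact: bounds0.
Qed.

Lemma triangle_bounds x y z : [set x; y; z]%SET \in faces K ->
  bounds (edge x z - (edge x y + edge y z)).
Proof.
move=> /loop_bounds/boundsN; rewrite /loop (edgeC z x).
by rewrite opprD opprK addrC.
Qed.

Lemma ffunMz (I : finType) (u : {ffun I -> int}) (m : int) i : (u *~ m) i = u i * m.
Proof.
case: m => m; rewrite ?NegzE ?mulrNz ?ffunE -pmulrn ffunMnE -mulr_natr natz//.
by rewrite mulrN.
Qed.

Lemma ffun_basis (I : finType) (c : {ffun I -> int}) :
  c = \sum_i [ffun j => (j == i)%:R : int] *~ c i.
Proof.
apply/ffunP => j; rewrite sum_ffunE (bigD1 j)//= ffunMz ffunE eqxx mul1r.
rewrite big1 ?addr0// => i ij; rewrite ffunMz ffunE.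
by rewrite eq_sym (negPf ij) mul0r.
Qed.

Lemma chain_cells n (c : chain K n) : c = \sum_f cell n (val f) *~ c f.
Proof.
by rewrite [LHS]ffun_basis.
Qed.

Lemma edge_ends (f : face K 2) :
  exists p : T * T, (rk p.1 < rk p.2)%N /\ val f = [set p.1; p.2]%SET.
Proof.
have /andP[_ /cards2P[x [y [xy ->]]]] := valP f.
case: (ltngtP (rk x) (rk y)) => [?|?|/rk_inj/eqP].
- by exists (x, y).
- by exists (y, x); rewrite finset.setUC.
- by rewrite (negPf xy).
Qed.

Definition edge_tail (f : face K 2) : T := (projT1 (cid (edge_ends f))).1.
Definition edge_head (f : face K 2) : T := (projT1 (cid (edge_ends f))).2.

Lemma tail_lt_head f : (rk (edge_tail f) < rk (edge_head f))%N.
Proof. by rewrite /edge_tail /edge_head; case: cid => p []. Qed.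

Lemma val_edge f : val f = [set edge_tail f; edge_head f]%SET.
Proof. by rewrite /edge_tail /edge_head; case: cid => p []. Qed.

Lemma cell_edge f : cell 2 (val f) = edge (edge_tail f) (edge_head f).
Proof. by rewrite edge_lt ?tail_lt_head// -val_edge. Qed.

Lemma chain_sum (c : chain K 2) : c = \sum_f edge (edge_tail f) (edge_head f) *~ c f.
Proof.
by rewrite [LHS]chain_cells; apply: eq_bigr => f _; rewrite cell_edge.
Qed.

(** The coefficient at [x] of the boundary, defined for arbitrary edge coefficients and also when
    [x] is not a vertex of [K]; it thus applies to the part of a cycle in [A]. *)
Definition vertex_boundary (a : face K 2 -> int) x : int :=
  \sum_f ((edge_head f == x)%:R - (edge_tail f == x)%:R) * a f.

Lemma boundary_vertex (c : chain K 2) (g : face K 1) x :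
  val g = [set x]%SET -> boundary c g = vertex_boundary c x.
Proof.
move=> gx; rewrite ffunE; apply: eq_bigr => f _.
rewrite val_edge incidence2 ?tail_lt_head// gx.
by rewrite !(inj_eq finset.set1_inj).
Qed.

Lemma cycle_vertex_boundary (c : chain K 2) x :
  boundary c = 0 -> vertex_boundary c x = 0.
Proof.
move=> c0; have [xK|xK] := boolP ([set x]%SET \in faces K).
  have gP : ([set x]%SET \in faces K) && (#|[set x]%SET| == 1%N).
    by rewrite xK cards1.
  pose g : face K 1 := exist _ [set x]%SET gP.
  by rewrite -(@boundary_vertex c g)// c0 ffunE.
rewrite /vertex_boundary big1// => f _.
have nf z : z \in val f -> (z == x) = false.
  move=> zf; apply: contraNF xK => /eqP <-; have /andP[fK _] := valP f.
  by apply: (faces_closed fK); rewrite finset.sub1set.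
by rewrite !nf ?subrr ?mul0r// val_edge !inE eqxx ?orbT.
Qed.

Lemma abel_sum (V : zmodType) (G : T -> V) (a : face K 2 -> int) :
  \sum_f (G (edge_head f) - G (edge_tail f)) *~ a f = \sum_x G x *~ vertex_boundary a x.
Proof.
have GE y : \sum_x G x *~ ((y == x)%:R : int) = G y.
  rewrite (bigD1 y)//= eqxx mulr1z big1 ?addr0// => x.
  by rewrite eq_sym => /negPf ->; rewrite mulr0z.
rewrite /vertex_boundary; under [RHS]eq_bigr do rewrite mulrz_sumr.
rewrite exchange_big; apply: eq_bigr => f _ /=.
under eq_bigr do rewrite mulrzA; rewrite -mulrz_suml; congr (_ *~ _).
by under eq_bigr do rewrite mulrzBr; rewrite sumrB !GE.
Qed.

Definition potential (A : {set {set T}}) (P : T -> chain K 2) : Prop :=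
  forall x y, [set x; y]%SET \in A -> bounds (edge x y - (P y - P x)).

Lemma subr_swap (V : zmodType) (e a b c d : V) :
  (e - (a - b)) - (e - (c - d)) = (b - d) - (a - c).
Proof.
have H u w : (e - u) - (e - w) = w - u by rewrite [- (e - w)]opprB addrC addrA subrK.
by rewrite H !opprB addrACA [RHS]addrACA [c + b]addrC.
Qed.

(** * Integer functionals detecting 1-boundaries *)

Section TwoPotentials.
Variables (A B : {set {set T}}) (PA PB : T -> chain K 2).
Hypotheses (downA : downclosed A) (downB : downclosed B).
Hypothesis facesAB : forall s, s \in faces K -> (s \in A) || (s \in B).
Hypotheses (potA : potential A PA) (potB : potential B PB).

Definition common x : bool := [set x]%SET \in (A :&: B)%SET.

Definition linked x y : bool := [set x; y]%SET \in (A :&: B)%SET.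

Definition component x : T := fingraph.root linked x.

Lemma linked_sym : connect_sym linked.
Proof. by apply: sym_connect_sym => x y; rewrite /linked finset.setUC. Qed.

Let D x := PA x - PB x.

(** Along an edge of both [A] and [B] the two potentials have the same increment modulo boundaries,
    namely the edge, so their difference does not change; a path to the root then gives the
    claim. *)
Lemma potential_component x : bounds (D x - D (component x)).
Proof.
have /connectP[p] := connect_root linked x; rewrite -/(component x).
elim: p x => [|y p IH] x /= => [_ ->|/andP[xy py] e].
  by rewrite subrr; exact: bounds0.
have -> : D x - D (component x) = (D x - D y) + (D y - D (component x)).
  by rewrite addrA subrK.
have cxy : component x = component y.
  by apply/eqP; rewrite (root_connect linked_sym); exact: connect1.
rewrite cxy; apply: boundsD; last by apply: IH => //; rewrite -cxy.
move: xy; rewrite /linked finset.inE => /andP[xyA xyB].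
have := boundsB (potA xyA) (potB xyB).
by rewrite subr_swap.
Qed.

(** The coboundary of [w] on the edges of [A], and 0 on the others. For [w] constant along common
    edges this is, up to sign, the connecting map of the Mayer-Vietoris sequence in cohomology. *)
Definition jump (w : T -> int) (c : chain K 2) : int :=
  \sum_(f : face K 2 | val f \in A) (w (edge_head f) - w (edge_tail f)) * c f.

Lemma jump_is_zmod_morphism w : zmod_morphism (jump w).
Proof.
move=> c d; rewrite /jump -sumrB; apply: eq_bigr => f _.
by rewrite !ffunE mulrBr.
Qed.

HB.instance Definition _ w := GRing.isZmodMorphism.Build
  (chain K 2) int (jump w) (@jump_is_zmod_morphism w).

Lemma jump_lt w x y : (rk x < rk y)%N -> [set x; y]%SET \in faces K ->
  jump w (edge x y) = if [set x; y]%SET \in A then w y - w x else 0.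
Proof.
move=> xy xyK; rewrite edge_lt// /jump.
have fP : ([set x; y]%SET \in faces K) && (#|[set x; y]%SET| == 2%N).
  by rewrite xyK cards2 rk_neq.
pose f : face K 2 := exist _ [set x; y]%SET fP.
have [tx hy] : edge_tail f = x /\ edge_head f = y.
  have := tail_lt_head f; have := val_edge f; rewrite /= => /finset.setP e.
  have : edge_tail f \in [set x; y]%SET by rewrite e !inE eqxx.
  have : edge_head f \in [set x; y]%SET by rewrite e !inE eqxx orbT.
  rewrite !inE => /orP[]/eqP-> /orP[]/eqP->; rewrite ?ltnn//.
  by rewrite ltnNge ltnW.
rewrite big_mkcond (bigD1 f)//= ffunE eqxx mulr1 tx hy big1 ?addr0// => g gf.
rewrite ffunE; case: ifP => // _; case: eqP => [e|]; last by rewrite mulr0.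
by case/eqP: gf; apply: val_inj.
Qed.

Lemma triangle_sorted (s : {set T}) : #|s| = 3%N -> exists x y z,
  [/\ (rk x < rk y)%N, (rk y < rk z)%N & s = [set x; y; z]%SET].
Proof.
move=> s3; have /card_gt0P[i0 i0s] : (0 < #|s|)%N by rewrite s3.
case: (arg_minnP (fun i => rk i) i0s) => x xs' xmin; have xs : x \in s := xs'.
have : #|(s :\ x)%SET| == 2%N by have := cardsD1 x s; rewrite s3 xs /= add1n => -[<-].
move=> /cards2P[y [z [yz sE]]].
have xlt u : u \in (s :\ x)%SET -> (rk x < rk u)%N.
  rewrite !inE => /andP[ux us]; rewrite ltn_neqAle xmin// andbT.
  by apply: contra ux => /eqP/rk_inj->.
have sx : s = [set x; y; z]%SET by rewrite -finset.setUA -sE finset.setD1K.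
have xy : (rk x < rk y)%N by apply: xlt; rewrite sE !inE eqxx.
have xz : (rk x < rk z)%N by apply: xlt; rewrite sE !inE eqxx orbT.
case: (ltngtP (rk y) (rk z)) => [h|h|/rk_inj/eqP].
- by exists x, y, z.
- exists x, z, y; split => //; rewrite sx.
  by apply/finset.setP => u; rewrite !inE -!orbA; congr (_ || _); rewrite orbC.
- by rewrite (negPf yz).
Qed.

(** On a triangle of [A] the increments of [w] cancel; a triangle outside [A] lies in [B], so its
    edges in [A] are common edges, along which [w] is constant. *)
Lemma jump_boundary w (d : chain K 3) :
  (forall x y, linked x y -> w x = w y) -> jump w (boundary d) = 0.
Proof.
move=> wl; rewrite [d]chain_cells !raddf_sum big1// => f _; rewrite !raddfMz.
have /andP[fK /eqP f3] := valP f.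
have [x [y [z [xy yz fE]]]] := triangle_sorted f3.
have sub u v : u \in val f -> v \in val f -> [set u; v]%SET \subset val f.
  by move=> uf vf; apply/fintype.subsetP => k; rewrite !inE => /orP[]/eqP->.
have [xf yf zf] : [/\ x \in val f, y \in val f & z \in val f].
  by rewrite fE !inE !eqxx ?orbT.
have xz := ltn_trans xy yz.
have E : boundary (cell 3 (val f)) = edge y z - edge x z + edge x y.
  by rewrite fE; apply: boundary_triangle => //; rewrite -fE.
rewrite /= E raddfD raddfB /= !jump_lt//; first last.
- exact: faces_closed fK (sub _ _ _ _).
- exact: faces_closed fK (sub _ _ _ _).
- exact: faces_closed fK (sub _ _ _ _).
suff -> : (if [set y; z]%SET \in A then w z - w y else 0) -
   (if [set x; z]%SET \in A then w z - w x else 0) +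
   (if [set x; y]%SET \in A then w y - w x else 0) = 0 by rewrite mul0rz.
have [fA|fA] := boolP (val f \in A).
  by rewrite !(downA fA) ?sub//; ring.
have fB : val f \in B by move: (facesAB fK); rewrite (negPf fA).
have h u v : u \in val f -> v \in val f ->
    (if [set u; v]%SET \in A then w v - w u else 0) = 0.
  move=> uf vf; case: ifP => // uvA; rewrite (wl u v) ?subrr//.
  by rewrite /linked inE uvA (downB fB (sub _ _ uf vf)).
by rewrite !h.
Qed.

(** A component is numbered by the rank of its root, so the indices stay below [#|T|]; a rank that
    belongs to no root yields the zero function. *)
Definition component_indicator (i : nat) x : int :=
  (common x && (rk (component x) == i))%:R.

Lemma component_indicator_linked i x y :
  linked x y -> component_indicator i x = component_indicator i y.
Proof.
move=> xy; rewrite /component_indicator /component.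
have -> : fingraph.root linked x = fingraph.root linked y.
  by apply/eqP; rewrite (root_connect linked_sym); exact: connect1.
move: xy; rewrite /linked /common inE => /andP[xA xB].
by rewrite !inE !(downA xA) ?(downB xB)// finset.sub1set !inE eqxx ?orbT.
Qed.

(** Edges in [A] are replaced by increments of [PA = D + PB], the others by increments of [PB].
    Summation by parts kills the [PB] part, as [c] is a cycle, and leaves [D] weighted by the
    boundary of the part of [c] in [A]; the total weight of each component is a jump. *)
Lemma cycle_bounds (c : chain K 2) : boundary c = 0 ->
  (forall i, (i < #|T|)%N -> jump (component_indicator i) c = 0) -> bounds c.
Proof.
move=> c0 jc.
pose a f : int := if val f \in A then c f else 0.
pose S := \sum_(f : face K 2)
  ((D (edge_head f) - D (edge_tail f)) *~ a f +
   (PB (edge_head f) - PB (edge_tail f)) *~ c f).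
have cS : bounds (c - S).
  rewrite [X in X - _]chain_sum -sumrB; apply: bounds_sum => f _; rewrite /a.
  have /andP[fK _] := valP f; case: ifP => fA.
    rewrite -mulrzDl -mulrzBl; apply: boundsMz.
    have -> : D (edge_head f) - D (edge_tail f) + (PB (edge_head f) - PB (edge_tail f)) =
              PA (edge_head f) - PA (edge_tail f).
      by rewrite /D addrACA subrK -opprD subrK.
    by apply: potA; rewrite -val_edge.
  rewrite mulr0z add0r -mulrzBl; apply: boundsMz; apply: potB; rewrite -val_edge.
  by have := facesAB fK; rewrite fA.
rewrite -[c](subrK S); apply: boundsD => //.
rewrite /S big_split/= (abel_sum PB) [X in _ + X]big1 ?addr0; last first.
  by move=> x _; rewrite cycle_vertex_boundary.
rewrite abel_sum.
(* A vertex outside [A] meets no edge of [A]; at a vertex outside [B] all edges lie in [A], so the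
   sum is the boundary of the cycle [c]. *)
have a0 x : ~~ common x -> vertex_boundary a x = 0.
  rewrite /common inE negb_and => xAB.
  pose inc (f : face K 2) : int := (edge_head f == x)%:R - (edge_tail f == x)%:R.
  have xf (f : face K 2) : inc f != 0 -> x \in val f.
    rewrite /inc val_edge !inE ![x == _]eq_sym.
    case: (edge_head f == x); rewrite ?orbT//=.
    by case: (edge_tail f == x); rewrite ?subrr.
  have xsub (f : face K 2) : x \in val f -> [set x]%SET \subset val f.
    by rewrite finset.sub1set.
  move: xAB => /orP[xA|xB].
    rewrite /vertex_boundary big1// => f _; rewrite -/(inc f).
    have [->|/xf/xsub xs] := eqVneq (inc f) 0; first by rewrite mul0r.
    rewrite /a; case: ifP => fA; last by rewrite mulr0.
    by rewrite (downA fA xs) in xA.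
  rewrite -(cycle_vertex_boundary x c0); apply: eq_bigr => f _; rewrite -/(inc f).
  have [->|/xf/xsub xs] := eqVneq (inc f) 0; first by rewrite !mul0r.
  rewrite /a; case: ifP => // fA; have /andP[fK _] := valP f.
  have := facesAB fK; rewrite fA /= => fB.
  by rewrite (downB fB xs) in xB.
(* Replacing [D] by its value at the root of the component costs only a boundary and lets the
   weights be collected by component. *)
pose S' := \sum_x D (component x) *~ vertex_boundary a x.
rewrite -[X in bounds X](subrK S'); apply: boundsD.
  rewrite /S' -sumrB; apply: bounds_sum => x _; rewrite -mulrzBl.
  by apply: boundsMz; exact: potential_component.
rewrite /S' (partition_big component predT)//=.
have -> : \sum_j \sum_(x | component x == j) D (component x) *~ vertex_boundary a x =
   \sum_j D j *~ jump (component_indicator (rk j)) c.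
  apply: eq_bigr => j _.
  rewrite (eq_bigr (fun x => D j *~ vertex_boundary a x)) => [|x /eqP -> //].
  rewrite -mulrz_sumr; congr (_ *~ _).
  have -> : jump (component_indicator (rk j)) c = \sum_(f : face K 2)
      (component_indicator (rk j) (edge_head f) -
       component_indicator (rk j) (edge_tail f)) *~ a f.
    rewrite /jump big_mkcond; apply: eq_bigr => f _; rewrite mulrzz /a.
    by case: ifP => //; rewrite mulr0.
  rewrite abel_sum big_mkcond; apply: eq_bigr => x _.
  rewrite /component_indicator; have [cx|cx] := boolP (common x).
    rewrite /= (inj_eq (@rk_inj)).
    by case: eqP => _; rewrite ?mulr1z ?mul0rz// mulrzz mul1r.
  by rewrite a0// mulr0z if_same.
rewrite big1; first exact: bounds0.
by move=> j _; rewrite jc ?mulr0z//; exact: ltn_ord.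
Qed.

End TwoPotentials.
End FirstHomology.

Lemma quotient_pi_eq0 (V : zmodType) (I : zmodClosed V) (z : V) :
  \pi_(Quotient.quot I) z = 0 <-> z \in I.
Proof.
have p0 : \pi_(Quotient.quot I) 0 = 0 by exact: raddf0.
by rewrite -p0; split=> [/eqP|zI]; [|apply/eqP]; rewrite -Quotient.idealrBE subr0.
Qed.

Section FreeHomology.
Variables (T : finType) (K : scomplex T).
Variables (A B : {set {set T}}) (PA PB : T -> chain K 2).
Hypotheses (downA : downclosed A) (downB : downclosed B).
Hypothesis facesAB : forall s, s \in faces K -> (s \in A) || (s \in B).
Hypotheses (potA : potential A PA) (potB : potential B PB).

Definition cycle_jump (i : nat) (z : cycle_group K 1) : int :=
  jump A (component_indicator A B i) (val z).

Lemma cycle_jump_is_zmod_morphism i : zmod_morphism (cycle_jump i).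
Proof. by move=> x y; rewrite /cycle_jump !raddfB. Qed.

HB.instance Definition _ i := GRing.isZmodMorphism.Build
  (cycle_group K 1) int (cycle_jump i) (@cycle_jump_is_zmod_morphism i).

Lemma cycle_jumpP (z : cycle_group K 1) :
  z \in @is_boundary T K 1 <->
  forall i, (i < #|T|)%N -> cycle_jump i z = 0.
Proof.
split=> [/asboolP[d dz] i _|jz].
  rewrite /cycle_jump -dz; apply: (jump_boundary downA downB facesAB).
  by move=> x y; exact: component_indicator_linked.
apply/asboolP; apply: (cycle_bounds downA downB facesAB potA potB).
  by have := valP z; rewrite inE => /eqP.
exact: jz.
Qed.

Lemma free_first_homology : free_abelian (reduced_homology K 1).
Proof.
apply: (@free_abelian_functionals (cycle_group K 1) (reduced_homology K 1)
  (\pi_(reduced_homology K 1)) (fun i => cycle_jump i) #|T|).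
  by move=> a; exists (repr a); exact: reprK.
by move=> z; rewrite -cycle_jumpP; exact: quotient_pi_eq0.
Qed.

End FreeHomology.

(** The potential at a vertex [x] is a path from [b0] through an apex of [x] to [x]. Modulo
    boundaries the apex does not matter, so both ends of an edge in [D e] can use [e], and the
    triangle on [e], [x], [y] gives the increment. *)
Lemma cone_cover_potential (T : finType) (K : scomplex T) (B : {set {set T}})
    (D : T -> {set {set T}}) (b0 : T) :
  cone_cover B D -> (forall s, s \in B -> s \in faces K) ->
  finset.set0 \in D b0 -> exists P, @potential T K B P.
Proof.
move=> cB BK b0D.
have /choice[a aP] x : exists a, [set x]%SET \in B -> [set x]%SET \in D a.
  have [/(proj1 (coverP cB _))[a xa]|xB] := boolP ([set x]%SET \in B).
    by exists a.
  by exists b0.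
have join (t s : {set T}) : s \in B -> t \subset s -> t \in faces K.
  by move=> sB ts; apply: (faces_closed (BK _ sB) ts).
have D0 c t : t \in D c -> finset.set0 \in D c.
  by move=> tc; apply: (cover_down cB tc); exact: finset.sub0set.
have apices c d e : finset.set0 \in D c -> finset.set0 \in D d ->
    finset.set0 \in D e -> [set c; d; e]%SET \in faces K.
  move=> cD dD eD; apply: BK; rewrite -[X in X \in _]finset.set0U.
  apply: (cover_join cB); first by apply/set0Pn; exists c; rewrite !inE eqxx.
  by move=> i; rewrite !inE => /orP[/orP[]|] /eqP->.
exists (fun x => edge K b0 (a x) + edge K (a x) x) => x y xyB.
have xB : [set x]%SET \in B.
  by apply: (cone_cover_down cB xyB); rewrite finset.sub1set !inE eqxx.
have yB : [set y]%SET \in B.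
  by apply: (cone_cover_down cB xyB); rewrite finset.sub1set !inE eqxx orbT.
have [e xye] := proj1 (coverP cB _) xyB.
(* The paths through [a u] and through [c] differ by the triangles on [b0, a u, c] and on
   [a u, c, u]; both are faces by [cover_join], the first one with the empty [s]. *)
have indep u c : [set u]%SET \in D c -> [set u]%SET \in B ->
    bounds (edge K b0 (a u) + edge K (a u) u - (edge K b0 c + edge K c u)).
  move=> uc uB; have ua := aP u uB.
  have t1 := triangle_bounds (apices _ _ _ b0D (D0 _ _ ua) (D0 _ _ uc)).
  have /triangle_bounds t2 : [set a u; c; u]%SET \in faces K.
    apply: (join _ ([set u] :|: [set a u; c])%SET).
      apply: (cover_join cB); first by apply/set0Pn; exists c; rewrite !inE eqxx orbT.
      by move=> i; rewrite !inE => /orP[] /eqP->.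
    by apply/fintype.subsetP => i; rewrite !inE => /orP[/orP[]|]->; rewrite ?orbT.
  apply: (bounds_trans (bounds_addl _ t2)); rewrite addrA.
  exact: (bounds_addr (edge K c u) (bounds_sym t1)).
have xe : [set x]%SET \in D e.
  by apply: (cover_down cB xye); rewrite finset.sub1set !inE eqxx.
have ye : [set y]%SET \in D e.
  by apply: (cover_down cB xye); rewrite finset.sub1set !inE eqxx orbT.
have /triangle_bounds t : [set e; x; y]%SET \in faces K.
  apply: (join _ ([set x; y] :|: [set e])%SET).
    apply: (cover_join cB); first by apply/set0Pn; exists e; rewrite !inE.
    by move=> i; rewrite !inE => /eqP->.
  by apply/fintype.subsetP => i; rewrite !inE => /orP[/orP[]|]->; rewrite ?orbT.
have yx := bounds_trans (indep y e ye yB) (bounds_addl (edge K b0 e) t).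
rewrite addrA in yx.
have := bounds_trans yx (bounds_addr (edge K x y) (bounds_sym (indep x e xe xB))).
by move=> /boundsN; rewrite !opprB addrAC addrC.
Qed.

(** * The star of a vertex and the stars opposite to it *)

(** The edges are the minimal nonfaces inside the vertex set of [L]; there the empty set and all
    singletons are faces, which gives edges of size at least 2. *)
Lemma complex_is_independence (T : finType) (L : {set {set T}}) :
  downclosed L -> finset.set0 \in L ->
  exists H' : hypergraph T, vertices H' = [set x | [set x]%SET \in L]%SET /\
    forall s, s \in faces (independence_complex H') <-> s \in L.
Proof.
move=> dL L0; pose V := [set x | [set x]%SET \in L]%SET.
pose P (s : {set T}) := (s \subset V) && (s \notin L).
pose E := [set s : {set T} | minset P s]%SET.
have E_sub e : e \in E -> e \subset V by rewrite inE => /minsetp/andP[].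
have E_min e f : e \in E -> f \in E -> e \subset f -> e = f.
  by rewrite !inE => /minsetp Pe /minsetP[_ fmin] ef; exact: fmin.
have E_size e : e \in E -> (2 <= #|e|)%N.
  rewrite inE => /minsetp/andP[eV eL]; rewrite ltn_neqAle eq_sym.
  apply/andP; split.
    apply: contra eL => /cards1P[x xe]; move: eV; rewrite xe finset.sub1set.
    by rewrite inE.
  by rewrite card_gt0; apply: contra eL => /eqP ->.
exists (Hypergraph E_sub E_min E_size); split=> // s; rewrite /= inE.
split=> [/andP[sV /forall_inP sE]|sL].
  apply: contraT => sL.
  have /minset_exists[e eP es] : P s by rewrite /P sV sL.
  by have := sE e; rewrite inE eP es => /(_ isT).
apply/andP; split.
  apply/fintype.subsetP => x xs; rewrite inE; apply: (dL _ _ sL).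
  by rewrite finset.sub1set.
apply/forall_inP => e; rewrite inE => /minsetp/andP[_]; apply: contra.
exact: dL.
Qed.

Section VertexCover.
Variables (T : finType) (H : hypergraph T) (v : T).
Local Notation K := (independence_complex H).
Implicit Types (s e : {set T}).

Definition star_faces : {set {set T}} := [set s : {set T} | (v |: s)%SET \in faces K]%SET.

(** The star is a cone from [v] alone; the empty family at every other vertex fits it into
    [cone_cover]. *)
Definition star_apex (a : T) : {set {set T}} :=
  if a == v then star_faces else finset.set0.

Lemma independentP s : reflect (s \subset vertices H /\
    forall e, e \in edges H -> ~ e \subset s) (s \in faces K).
Proof.
rewrite inE; apply: (iffP andP) => [[sV /forall_inP h]|[sV h]]; split=> //.
  by move=> e /h/negP.
by apply/forall_inP => e /h/negP.
Qed.

Lemma star_facesE s : (s \in star_faces) = ((v |: s)%SET \in faces K).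
Proof. by rewrite [LHS]inE. Qed.

Lemma star_down : downclosed star_faces.
Proof.
move=> s t; rewrite !star_facesE => sK ts; apply: (faces_closed sK).
exact: finset.setUS.
Qed.

Lemma star_cone_cover : cone_cover star_faces star_apex.
Proof.
have sub a s : s \in star_apex a -> a = v /\ s \in star_faces.
  by rewrite /star_apex; case: eqP => // _; rewrite inE.
split.
- move=> a s t /sub[-> sA] ts; rewrite /star_apex eqxx.
  exact: star_down sA ts.
- move=> s; split=> [sA|[a /sub[]//]].
  by exists v; rewrite /star_apex eqxx.
- move=> s I /set0Pn[a aI] sI; have [_ sA] := sub _ _ (sI a aI).
  move: sA; rewrite !star_facesE => sA; apply: (faces_closed sA).
  apply/fintype.subsetP => x; rewrite !inE => /orP[->//|/orP[->|xI]].
    by rewrite orbT.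
  by have [-> _] := sub _ _ (sI x xI); rewrite eqxx.
Qed.

Definition opposite_faces : {set {set T}} :=
  [set s : {set T} | [exists e in edges H,
    (v \in e) && ((s :|: e :\ v)%SET \in faces K)]]%SET.

(** Indexed by vertices rather than edges, since [cover_map] needs apexes in [T]: the star of
    [e :\ v] can be coned from each of its vertices, and the edges through [v] and [a] are treated
    together. *)
Definition opposite_apex (a : T) : {set {set T}} :=
  [set s : {set T} | [exists e in edges H,
    [&& v \in e, a \in (e :\ v)%SET & (s :|: e :\ v)%SET \in faces K]]]%SET.

Lemma opposite_facesP s : reflect (exists e, [/\ e \in edges H, v \in e &
  (s :|: e :\ v)%SET \in faces K]) (s \in opposite_faces).
Proof.
rewrite [s \in _]inE; apply: (iffP exists_inP) => [[e eH /andP[ve sK]]|[e [eH ve sK]]].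
  by exists e.
by exists e => //; rewrite ve.
Qed.

Lemma opposite_apexP a s : reflect (exists e, [/\ e \in edges H, v \in e,
  a \in (e :\ v)%SET & (s :|: e :\ v)%SET \in faces K]) (s \in opposite_apex a).
Proof.
rewrite [s \in _]inE.
apply: (iffP exists_inP) => [[e eH /and3P[ve ae sK]]|[e [eH ve ae sK]]].
  by exists e.
by exists e => //; rewrite ve ae.
Qed.

Lemma notin_opposite s e : e \in edges H -> v \in e ->
  (s :|: e :\ v)%SET \in faces K -> v \notin s.
Proof.
move=> eH ve /independentP[_ /(_ e eH) h]; apply/negP => vs; apply: h.
apply/fintype.subsetP => x xe; rewrite !inE xe andbT.
by have [->|_] := eqVneq x v; rewrite ?vs ?orbT.
Qed.

Hypothesis v_no_triangle : ~ on_induced_berge_cycle H 3 v.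

Lemma no_triangle (e f g : {set T}) x y :
  e \in edges H -> f \in edges H -> g \in edges H ->
  v \in e -> x \in e -> y \notin e -> x \in f -> y \in f -> v \notin f ->
  y \in g -> v \in g -> x \notin g -> False.
Proof.
move=> eH fH gH ve xe ye xf yf vf yg vg xg; apply: v_no_triangle.
pose vs (k : 'I_3) := nth v [:: v; x; y] k.
pose es (k : 'I_3) := nth e [:: e; f; g] k.
have nvx : v == x = false by apply/negP => /eqP vx; rewrite -vx vg in xg.
have nvy : v == y = false by apply/negP => /eqP vy; rewrite -vy ve in ye.
have nxy : x == y = false by apply/negP => /eqP xy; rewrite -xy xe in ye.
have nef : e == f = false by apply/negP => /eqP ef; rewrite -ef ve in vf.
have neg : e == g = false by apply/negP => /eqP ef; rewrite -ef xe in xg.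
have nfg : f == g = false by apply/negP => /eqP ef; rewrite -ef xf in xg.
have vsE : [set vs j | j : 'I_3]%SET = [set v; x; y]%SET.
  apply/finset.setP => z; apply/imsetP/idP => [[[[|[|[|//]]] kP] _ ->]|].
  - by rewrite !inE eqxx.
  - by rewrite !inE eqxx orbT.
  - by rewrite !inE eqxx orbT.
  rewrite !inE => /orP[/orP[]|] /eqP ->.
  - by exists (@Ordinal 3 0 isT).
  - by exists (@Ordinal 3 1 isT).
  - by exists (@Ordinal 3 2 isT).
exists vs, es; split; last by exists ord0.
split.
- split.
  + move=> i j /eqP; rewrite nth_uniq ?ltn_ord//; first by move=> /eqP/val_inj.
    by rewrite /= !inE nvx nvy nxy.
  + move=> i j /eqP; rewrite nth_uniq ?ltn_ord//; first by move=> /eqP/val_inj.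
    by rewrite /= !inE nef neg nfg.
  + by move=> [[|[|[|//]]] i].
  + by move=> [[|[|[|//]]] i].
- move=> [[|[|[|//]]] i]; rewrite vsE; apply/finset.setP => z; rewrite !inE /vs /es /=.
  + have [->|_] := eqVneq z v; first by rewrite ve.
    have [->|_] := eqVneq z x; first by rewrite xe.
    by have [->|_] := eqVneq z y; rewrite ?(negPf ye) ?andbF.
  + have [->|_] := eqVneq z v; first by rewrite (negPf vf) nvx nvy.
    have [->|_] := eqVneq z x; first by rewrite xf.
    by have [->|_] := eqVneq z y; rewrite ?yf ?andbF.
  + have [->|_] := eqVneq z v; first by rewrite vg orbT.
    have [->|_] := eqVneq z x; first by rewrite (negPf xg) nxy.
    by have [->|_] := eqVneq z y; rewrite ?yg ?andbF.
(* In a cycle of length 3 distinct vertices are always consecutive, so this condition is vacuous. *)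
- by move=> [[|[|[|//]]] i] [[|[|[|//]]] j].
Qed.

(* A minimal family of the [F a] whose union with [s] contains an edge [f] has
   two members, each contributing a private vertex of [f]: with [v] these
   vertices span an induced Berge triangle. *)
Lemma opposite_join s (I : {set T}) (F : T -> {set T}) : I != finset.set0 ->
  (forall a, a \in I -> [/\ F a \in edges H, v \in F a &
     (s :|: F a :\ v)%SET \in faces K]) ->
  (s :|: \bigcup_(a in I) (F a :\ v))%SET \in faces K.
Proof.
move=> /set0Pn[a0 a0I] FI; have [F0 v0 s0] := FI _ a0I.
have vs := notin_opposite F0 v0 s0.
apply/independentP; split.
  rewrite finset.subUset; move/independentP: s0 => [+ _].
  rewrite finset.subUset => /andP[-> _]; apply/bigcupsP => a /FI[_ _].
  by move=> /independentP[+ _]; rewrite finset.subUset => /andP[].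
move=> f fH.
have nf a : a \in I -> ~ f \subset (s :|: F a :\ v)%SET.
  by move=> /FI[_ _ /independentP[_ /(_ f fH)]].
pose U (J : {set T}) := (s :|: \bigcup_(a in J) (F a :\ v))%SET.
(* Minimality of the family enters as induction on its size: every smaller subfamily already fails
   to cover [f]. *)
suff H0 n (J : {set T}) : (#|J| <= n)%N -> J \subset I -> ~ f \subset U J.
  exact: (H0 _ _ (leqnn _)).
elim: n J => [|n IH] J.
  rewrite leqn0 cards_eq0 => /eqP -> _; rewrite /U big_set0 finset.setU0 => fs.
  by apply: (nf _ a0I); apply: (fintype.subset_trans fs); exact: finset.subsetUl.
move=> Jn JI fU.
have drop i : i \in J -> exists x, [/\ x \in f, x \in (F i :\ v)%SET &
    forall j, j \in J -> j != i -> x \notin (F j :\ v)%SET].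
  move=> iJ; have := IH (J :\ i)%SET.
  have Jin : (#|J :\ i| <= n)%N by move: Jn; rewrite (cardsD1 i J) iJ.
  have JiI : (J :\ i)%SET \subset I.
    by apply: (fintype.subset_trans _ JI); exact: finset.subsetDl.
  move=> /(_ Jin JiI)/negP/subsetPn[x xf xU]; exists x.
  move: xU; rewrite inE negb_or => /andP[xs /bigcupP xU].
  have other j : j \in J -> j != i -> x \notin (F j :\ v)%SET.
    by move=> jJ ji; apply/negP => xj; apply: xU; exists j; rewrite // !inE ji.
  split=> //; have /fintype.subsetP/(_ x xf) := fU.
  rewrite inE (negPf xs) => /bigcupP[j jJ xj].
  by have [<-//|ji] := eqVneq j i; rewrite (negPf (other j jJ ji)) in xj.
(* With at most one member the union lies in a face given by hypothesis; two members are needed for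
   the triangle. *)
have [J1|J1] := leqP #|J| 1.
  have [J0|/set0Pn[a aJ]] := eqVneq J finset.set0.
    move: fU; rewrite J0 /U big_set0 finset.setU0 => fs.
    by apply: (nf _ a0I); apply: (fintype.subset_trans fs); exact: finset.subsetUl.
  have Ja : J = [set a]%SET.
    by apply/eqP; rewrite eq_sym eqEcard finset.sub1set aJ cards1.
  apply: (nf a); first exact: (fintype.subsetP JI).
  by move: fU; rewrite Ja /U big_set1.
have [i [j [iJ jJ ij]]] := card_gt1P J1.
have [x [xf xi xother]] := drop i iJ; have [y [yf yj yother]] := drop j jJ.
have [Fi vi _] := FI i (fintype.subsetP JI _ iJ).
have [Fj vj _] := FI j (fintype.subsetP JI _ jJ).
have xj := xother j jJ; rewrite eq_sym in xj.
have {xj}xj := xj ij; have yi := yother i iJ ij.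
have vf : v \notin f.
  apply/negP => /(fintype.subsetP fU); rewrite inE (negPf vs) => /bigcupP[a _].
  by rewrite !inE eqxx.
move: xi xj yi yj; rewrite !inE => /andP[xv xi]; rewrite xv /= => xj.
move=> + /andP[yv yj]; rewrite yv /= => yi.
exact: (no_triangle Fi fH Fj vi xi yi xf yf vf yj vj xj).
Qed.

Lemma edge_neighbour e : e \in edges H -> v \in e -> exists a, a \in (e :\ v)%SET.
Proof.
move=> eH ve; apply/set0Pn; rewrite -card_gt0.
by have := edges_size eH; rewrite (cardsD1 v e) ve.
Qed.

Lemma opposite_cone_cover : cone_cover opposite_faces opposite_apex.
Proof.
split.
- move=> a s t /opposite_apexP[e [eH ve ae sK]] ts; apply/opposite_apexP.
  by exists e; split => //; apply: (faces_closed sK); exact: finset.setSU.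
- move=> s; split=> [/opposite_facesP[e [eH ve sK]]|[a /opposite_apexP[e [eH ve ae sK]]]].
    by have [a ae] := edge_neighbour eH ve; exists a; apply/opposite_apexP; exists e.
  by apply/opposite_facesP; exists e.
- move=> s I I0 sI.
  have /choice[F FP] a : exists e, a \in I -> [/\ e \in edges H, v \in e,
      a \in (e :\ v)%SET & (s :|: e :\ v)%SET \in faces K].
    have [/sI/opposite_apexP[e ?]|_] := boolP (a \in I); first by exists e.
    by exists finset.set0.
  have [a0 a0I] := set0Pn _ I0; have [F0 v0 aF0 _] := FP _ a0I.
  apply/opposite_facesP; exists (F a0); split => //.
  have FI a : a \in I -> [/\ F a \in edges H, v \in F a &
      (s :|: F a :\ v)%SET \in faces K] by move=> /FP[].
  (* Each [a] in [I] lies in its own [F a :\ v], so the joined face already contains [I], and also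
     [F a0 :\ v]. *)
  apply: (faces_closed (opposite_join I0 FI)).
  apply/fintype.subsetP => x; rewrite 2!inE => /orP[/orP[xs|xI]|xF].
  + by rewrite inE xs.
  + rewrite inE; apply/orP; right; apply/bigcupP; exists x => //.
    by have [_ _] := FP _ xI.
  + by rewrite inE; apply/orP; right; apply/bigcupP; exists a0.
Qed.

Hypothesis v_vertex : v \in vertices H.
Hypothesis v_not_isolated : ~ isolated_vertex H v.

Lemma faces_star_opposite s :
  s \in faces K <-> s \in star_faces \/ s \in opposite_faces.
Proof.
split=> [sK|[]]; last first.
- move=> /opposite_facesP[e [_ _ sK]]; apply: (faces_closed sK).
  exact: finset.subsetUl.
- by rewrite star_facesE => sK; apply: (faces_closed sK); exact: finset.subsetUr.
rewrite star_facesE; have [|nK] := boolP ((v |: s)%SET \in faces K); first by left.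
right; have [sV sE] := independentP s sK.
have [e [eH es]] : exists e, e \in edges H /\ e \subset (v |: s)%SET.
  apply: contrapT => h; case/negP: nK; apply/independentP; split.
    by rewrite finset.subUset finset.sub1set v_vertex.
  by move=> e eH es; apply: h; exists e.
have ve : v \in e.
  apply: contraT => ve; case: (sE e eH); apply/fintype.subsetP => x xe.
  have := fintype.subsetP es x xe; rewrite !inE => /orP[/eqP xv|//].
  by rewrite -xv xe in ve.
apply/opposite_facesP; exists e; split=> //.
rewrite (finset.setUidPl _)//; apply/fintype.subsetP => x; rewrite !inE => /andP[xv xe].
by have := fintype.subsetP es x xe; rewrite !inE (negPf xv).
Qed.

Lemma star_apex0 : finset.set0 \in star_apex v.
Proof.
rewrite /star_apex eqxx star_facesE finset.setU0; apply/independentP; split.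
  by rewrite finset.sub1set.
move=> e eH /subset_leq_card; rewrite cards1 => e1.
by have := leq_trans (edges_size eH) e1.
Qed.

(** For an edge [e] through [v], minimality makes [e :\ v] a face: an edge inside it would equal [e]
    and yet miss [v]. *)
Lemma opposite_apex0 : exists a, finset.set0 \in opposite_apex a.
Proof.
move/existsNP: v_not_isolated => [e /not_implyP[eH /negP]]; rewrite negbK => ve.
have [a ae] := edge_neighbour eH ve; exists a; apply/opposite_apexP; exists e.
split=> //; rewrite finset.set0U; apply/independentP; split.
  by apply: (fintype.subset_trans (finset.subsetDl _ _)); exact: edges_sub.
move=> f fH fe; have fe' := fintype.subset_trans fe (finset.subsetDl _ _).
have ef := edges_minimal fH eH fe'.
by have := fintype.subsetP fe v; rewrite ef ve !inE eqxx => /(_ isT).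
Qed.

Lemma vertex_suspension (R : realType) : exists H' : hypergraph T,
  vertices H' \subset (vertices H :\ v)%SET /\
  homotopy_equivalent R (realization R K)
    (suspension R (realization R (independence_complex H'))).
Proof.
have [b b0] := opposite_apex0.
pose C c := if c then opposite_faces else star_faces.
pose D c := if c then opposite_apex else star_apex.
pose apex c := if c then b else v.
have coverC c : cone_cover (C c) (D c).
  by case: c; [exact: opposite_cone_cover|exact: star_cone_cover].
have apexD c : finset.set0 \in D c (apex c).
  by case: c; [exact: b0|exact: star_apex0].
have C0 c : finset.set0 \in C c.
  by apply: (proj2 (coverP (coverC c) _)); exists (apex c).
pose L := (opposite_faces :&: star_faces)%SET.
have downL : downclosed L.
  move=> s t; rewrite !finset.in_setI => /andP[sB sA] ts.
  by rewrite (cone_cover_down opposite_cone_cover sB ts) (star_down sA ts).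
have L0 : finset.set0 \in L by rewrite finset.in_setI (C0 true) (C0 false).
have [H' [VH' LH']] := complex_is_independence downL L0.
have facesK s : s \in faces K <-> exists c, s \in C c.
  split=> [/faces_star_opposite[?|?]|[[] ?]]; first by exists false.
  - by exists true.
  - by apply/faces_star_opposite; right.
  - by apply/faces_star_opposite; left.
have facesL s : s \in faces (independence_complex H') <-> forall c, s \in C c.
  split=> [/LH'|h]; last by apply/LH'; rewrite finset.in_setI (h true) (h false).
  by rewrite finset.in_setI => /andP[sB sA] [].
exists H'; split.
  rewrite VH'; apply/fintype.subsetP => x.
  rewrite [_ \in [set _ | _]%SET]inE finset.in_setI.
  move=> /andP[/opposite_facesP[e [eH ve xK]] xA].
  rewrite finset.in_setD1; apply/andP; split.
    by have := notin_opposite eH ve xK; rewrite finset.in_set1 eq_sym.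
  have /independentP[xV _] := proj2 (faces_star_opposite _) (or_introl xA).
  by move: xV; rewrite finset.sub1set.
have [f [g [cf cg fK gK]]] := @suspension_homeomorphic R T (independence_complex H')
  (proj2 (facesL _) C0).
apply: (homotopy_equivalent_homeomorphic cf cg fK gK).
exact: (@realization_two_cones R T K (independence_complex H') C D apex).
Qed.

Lemma free_vertex_homology : free_abelian (reduced_homology K 1).
Proof.
have [b b0] := opposite_apex0.
have [PA potA] := @cone_cover_potential T K _ _ v star_cone_cover
  (fun s sA => proj2 (faces_star_opposite s) (or_introl sA)) star_apex0.
have [PB potB] := @cone_cover_potential T K _ _ b opposite_cone_cover
  (fun s sB => proj2 (faces_star_opposite s) (or_intror sB)) b0.
apply: (free_first_homology (cone_cover_down star_cone_cover)
  (cone_cover_down opposite_cone_cover) _ potA potB).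
by move=> s /faces_star_opposite/orP.
Qed.

End VertexCover.

Theorem theorem1p2 (R : realType) (T : finType) (H : hypergraph T) (v : T)
    (v_vertex : v \in vertices H)
    (v_not_isolated : ~ isolated_vertex H v)
    (v_no_triangle : ~ on_induced_berge_cycle H 3 v) :
  [/\ exists H' : hypergraph T,
        vertices H' \subset (vertices H :\ v)%SET /\
        homotopy_equivalent R (realization R (independence_complex H))
          (suspension R (realization R (independence_complex H'))),
      exists Y : topologicalType,
        homotopy_equivalent R (realization R (independence_complex H))
          (suspension R Y)
    & free_abelian (reduced_homology (independence_complex H) 1)].
Proof.
have [H' [VH' eqH']] := vertex_suspension v_no_triangle v_vertex v_not_isolated R.
split; first by exists H'.
- by exists (realization R (independence_complex H')).
- exact: free_vertex_homology v_no_triangle v_vertex v_not_isolated.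
Qed.
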